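(* Let $r\in(0,\infty)$ and $s\in(r,d+r)$. Let $P$ be a Borel probability measure on $\mathbb{R}^d$ with absolutely continuous part $P^a\ne0$ and $\int\|x\|^{r+\delta}\,dP(x)<+\infty$ for some $\delta>0$. For every $n\ge1$ let $\alpha_n$ be an $L^r$-optimal $n$-quantizer for $P$. Assume that $$\int_{B(0,M)^c}\left(\sup_{t\le 2b\|x\|}\frac{\lambda_d(B(x,t))}{P(B(x,t))}\right)^{s/(d+r)}dP(x)<+\infty$$ for some $M,b\in(0,\infty)$. Then $$\sup_n n^{s/d}\int d(x,\alpha_n)^s\,dP(x)<+\infty.$$
   Context: $\mathbb{R}^d$ ($d\ge 1$) is equipped with an arbitrary norm $\|\cdot\|$; $d(x,A)=\inf_{a\in A}\|x-a\|$; $B(x,\rho)$ is the closed ball with center $x$ and radius $\rho$; $\lambda_d$ is Lebesgue measure; $P^a$ is the absolutely continuous part of $P$ with respect to $\lambda_d$. The supremum is over nonnegative $t$, with the convention $\frac00:=0$. An $L^r$-optimal $n$-quantizer for $P$ is a nonempty set $\alpha\subset\mathbb{R}^d$ with $\mathrm{card}(\alpha)\le n$ minimizing $\int d(x,\alpha)^r\,dP(x)$ among all nonempty subsets of $\mathbb{R}^d$ of cardinality at most $n$. *)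

(* Defs.v *)
From HB Require Import structures.
From mathcomp Require Import all_boot all_order all_algebra.
From mathcomp Require Import all_classical all_reals all_analysis.
From mathcomp Require Import measurable_realfun ring lra.

Set Implicit Arguments.
Unset Strict Implicit.
Unset Printing Implicit Defensive.

Import Order.TTheory GRing.Theory Num.Theory.
Import numFieldNormedType.Exports.

Local Open Scope classical_set_scope.
Local Open Scope ring_scope.

(* R^d with its Borel sigma-algebra. The topology of 'rV[R]_d is that of the
   sup norm, hence that of every norm on R^d. *)
Definition borel_rV (R : realType) (d : nat) : Type :=
  g_sigma_algebraType (@open 'rV[R]_d).

HB.instance Definition _ (R : realType) (d : nat) :=
  Measurable.on (borel_rV R d).

Section lebesgue_rV.
Context {R : realType}.

Definition cons_rV n (xv : measurableTypeR R * borel_rV R n) :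
  borel_rV R n.+1 := row_mx (xv.1 : R)%:M (xv.2 : 'rV[R]_n).

(* Lebesgue measure on R^d, as the d-fold product of that on R. *)
Fixpoint lebesgue_rV (d : nat) : set (borel_rV R d) -> \bar R :=
  match d with
  | 0%N => @dirac _ (borel_rV R 0) (0 : 'rV[R]_0) R
  | n.+1 => pushforward (lebesgue_measure \x @lebesgue_rV n)%E (@cons_rV n)
  end.

Lemma cons_rV_head n xv : (@cons_rV n xv : 'rV[R]_n.+1) ord0 ord0 = xv.1.
Proof.
have := @row_mxEl R 1 1 n (xv.1 : R)%:M xv.2 ord0 ord0.
rewrite [X in _ = X]mxE mulr1n => <-; congr (_ _ _).
exact: val_inj.
Qed.

Lemma cons_rV_tail n xv (j : 'I_n) :
  (@cons_rV n xv : 'rV[R]_n.+1) ord0 (lift ord0 j) = (xv.2 : 'rV[R]_n) ord0 j.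
Proof.
rewrite -(@row_mxEr R 1 1 n (xv.1 : R)%:M xv.2 ord0 j); congr (_ _ _).
exact: val_inj.
Qed.

Lemma measurable_cons_rV n : measurable_fun [set: _] (@cons_rV n).
Proof.
have := @measurability _ _ _ (borel_rV R n.+1) setT (@cons_rV n)
  (@open 'rV[R]_n.+1) erefl.
apply => _ [U oU <-].
rewrite setTI.
pose rad (q : rat * 'rV[rat]_n * nat) : R := q.2.+1%:R^-1.
pose rect q : set (measurableTypeR R * borel_rV R n) :=
  ball (ratr q.1.1 : R) (rad q) `*` ball (map_mx ratr q.1.2 : 'rV[R]_n) (rad q).
have rad0 q : 0 < rad q by rewrite invr_gt0.
have mrect q : measurable (rect q).
  apply: measurableX; first by apply: open_measurable; exact: (@ball_open R R^o).
  by apply: sub_sigma_algebra; exact: (@ball_open R 'rV[R]_n).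
pose F q := if pselect (rect q `<=` @cons_rV n @^-1` U) then rect q else set0.
rewrite (_ : _ @^-1` _ = \bigcup_q F q); last first.
  apply/seteqP; split => [[x v] /= Uxv|xv [q _]]; last first.
    by rewrite /F; case: pselect => //= h; exact: h.
  have /nbhs_ballP[e /= e0 eU] : nbhs (cons_rV (x, v) : 'rV[R]_n.+1) U.
    exact: open_nbhs_nbhs.
  have [k ke] : exists k : nat, k.+1%:R^-1 < e / 2.
    have e20 : 0 < e / 2 by rewrite divr_gt0.
    have [k _ /(_ k (leqnn k)) /= h] := near_infty_natSinv_lt (PosNum e20).
    by exists k.
  set d := k.+1%:R^-1 in ke; have d0 : (0 : R) < d by rewrite invr_gt0.
  have approx (y : R) : {q : rat | ball (ratr q : R) d y}.
    apply: cid.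
    have [|q] := @rat_in_itvoo R (y - d) y; first by rewrite ltrBlDr ltrDl.
    rewrite in_itv /= => /andP[q1 q2]; exists q.
    by rewrite /ball /= ltr_norml; apply/andP; split; lra.
  pose q := (sval (approx x), \row_j sval (approx ((v : 'rV[R]_n) ord0 j)), k).
  have vq : ball (map_mx ratr q.1.2 : 'rV[R]_n) d v.
    split => // i j; rewrite !mxE (_ : i = ord0); last exact: ord1.
    exact: (svalP (approx ((v : 'rV[R]_n) ord0 j))).
  exists q => //; rewrite /F; case: pselect => [h|[]] /=.
    by split => //=; exact: (svalP (approx x)).
  move=> [y w] [/= yq wq]; apply: eU; split => // i j; rewrite (_ : i = ord0); last exact: ord1.
  have close (a b c : R) : ball a d b -> ball a d c -> ball b e c.
    move=> /ball_sym ab ac; apply: le_ball (ball_triangle ab ac); lra.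
  case: (unliftP ord0 j) => [m ->|->].
    rewrite !cons_rV_tail /=.
    exact: close (proj2 vq ord0 m) (proj2 wq ord0 m).
  rewrite !cons_rV_head /=; apply: close yq; exact: (svalP (approx x)).
apply: countable_bigcupT_measurable; first exact: countableP.
by move=> q; rewrite /F; case: pselect => h /=; [exact: mrect|exact: measurable0].
Qed.

Definition box_rV n (a b : 'rV[R]_n) : set (borel_rV R n) :=
  [set x | forall i, a ord0 i <= (x : 'rV[R]_n) ord0 i <= b ord0 i].

Lemma measurable_box_rV n (a b : 'rV[R]_n) : measurable (box_rV a b).
Proof.
rewrite -[box_rV a b]setCK; apply: measurableC; apply: sub_sigma_algebra.
rewrite /= openC.
have -> : box_rV a b = \bigcap_i
    ((fun x : 'rV[R]_n => x ord0 i) @^-1` `[a ord0 i, b ord0 i]).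
  apply/seteqP; split => x /= xab i; first by move=> _; rewrite /= in_itv; exact: xab.
  by have := xab i I; rewrite /= in_itv.
apply: closed_bigI => i _; apply: closed_comp; last exact: itv_closed.
by move=> x _; exact: coord_continuous.
Qed.


Lemma lebesgue_rV_spec n :
  [/\ @lebesgue_rV n set0 = 0%E, forall A, (0 <= @lebesgue_rV n A)%E,
      semi_sigma_additive (@lebesgue_rV n) &
      forall a b : 'rV[R]_n, (forall i, a ord0 i <= b ord0 i) ->
        @lebesgue_rV n (box_rV a b) = (\prod_i (b ord0 i - a ord0 i))%:E].
Proof.
elim: n => [|n [m0 mge0 madd mbox]].
  pose del : {measure set (borel_rV R 0) -> \bar R} :=
    @dirac _ (borel_rV R 0) (0 : 'rV[R]_0) R.
  split; [exact: (measure0 del)|exact: (measure_ge0 del)|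
          exact: (@measure_semi_sigma_additive _ _ _ del)|].
  by move=> a b _; rewrite big_ord0 /= /dirac indicE mem_set// => -[].
pose M := isMeasure.Build _ _ _ (@lebesgue_rV n) m0 mge0 madd.
pose mu : {measure set (borel_rV R n) -> \bar R} := HB.pack (@lebesgue_rV n) M.
have sf : sigma_finite setT mu.
  exists (fun k => box_rV (const_mx (- k%:R)) (const_mx k%:R)).
    apply/esym/seteqP; split => // x _.
    have [k xk] : exists k : nat, `|(x : 'rV[R]_n)| <= k%:R.
      by exists (Num.bound `|(x : 'rV[R]_n)|); apply/ltW; rewrite archi_boundP.
    exists k => // i; rewrite !mxE -ler_norml (le_trans _ xk)//.
    rewrite [leRHS]/Num.norm /= mx_normrE.
    exact: (le_bigmax _ (fun ij => `|(x : 'rV[R]_n) ij.1 ij.2|) (ord0, i)).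
  move=> k; split; first exact: measurable_box_rV.
  by rewrite /= mbox ?ltry// => i; rewrite !mxE; have := ler0n R k; lra.
pose S := Measure_isSigmaFinite.Build _ _ _ mu sf.
pose m : {sigma_finite_measure set (borel_rV R n) -> \bar R} :=
  HB.pack (Measure.sort mu) S.
have [p pE] : exists p : {measure set (borel_rV R n.+1) -> \bar R},
    @lebesgue_rV n.+1 = p :> (set (borel_rV R n.+1) -> \bar R).
  unshelve eexists.
    by refine (pushforward (lebesgue_measure \x m)%E (@cons_rV n)
             : {measure set (borel_rV R n.+1) -> \bar R}); exact: measurable_cons_rV.
  by [].
split; [by rewrite pE measure0|by move=> A; rewrite pE measure_ge0|
  by rewrite pE; exact: measure_semi_sigma_additive|].
move=> a b ab.
have -> : @lebesgue_rV n.+1 (box_rV a b) = (lebesgue_measure \x m)%E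
    (`[a ord0 ord0, b ord0 ord0]%classic `*`
     box_rV (\row_j a ord0 (lift ord0 j)) (\row_j b ord0 (lift ord0 j))).
  rewrite /= /pushforward; congr product_measure1; apply/seteqP; split => -[x v] /=.
    move=> h; split; first by have := h ord0; rewrite cons_rV_head in_itv.
    by move=> j; rewrite !mxE; have := h (lift ord0 j); rewrite cons_rV_tail.
  move=> [h1 h2] i; case: (unliftP ord0 i) => [j ->|->].
    by rewrite cons_rV_tail; have := h2 j; rewrite !mxE.
  by rewrite cons_rV_head; move: h1; rewrite in_itv.
rewrite product_measure1E//; last exact: measurable_box_rV.
rewrite big_ord_recl EFinM; congr (_ * _)%E.
  rewrite [LHS](lebesgue_measure_itv `[a ord0 ord0, b ord0 ord0]) /= lte_fin.
  case: ltP => // ba.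
  by rewrite (@le_anti _ _ (b ord0 ord0) (a ord0 ord0)) ?subrr// ba ab.
rewrite /= mbox; last by move=> j; rewrite !mxE.
by congr (_%:E); apply: eq_bigr => j _; rewrite !mxE.
Qed.

HB.instance Definition _ n := isMeasure.Build _ _ _ (@lebesgue_rV n)
  (let: And4 h _ _ _ := lebesgue_rV_spec n in h)
  (let: And4 _ h _ _ := lebesgue_rV_spec n in h)
  (let: And4 _ _ h _ := lebesgue_rV_spec n in h).

Lemma lebesgue_rV_box n (a b : 'rV[R]_n) :
  (forall i, a ord0 i <= b ord0 i) ->
  @lebesgue_rV n (box_rV a b) = (\prod_i (b ord0 i - a ord0 i))%:E.
Proof. by have [_ _ _] := lebesgue_rV_spec n; exact. Qed.

End lebesgue_rV.
Arguments lebesgue_rV R d _ : clear implicits.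

(* P = Pa + Ps with Pa absolutely continuous and Ps singular w.r.t. mu; this
   determines Pa, the absolutely continuous part of P, uniquely when P is
   finite. *)
Definition lebesgue_decomposition (disp : measure_display)
    (T : measurableType disp) (R : realType)
    (mu P Pa Ps : {measure set T -> \bar R}) : Prop :=
  [/\ forall A, measurable A -> P A = (Pa A + Ps A)%E,
      Pa `<< mu &
      exists S, [/\ measurable S, mu S = 0%E & Ps (~` S) = 0%E]].

Section quantization.
Context {R : realType} {d : nat}.
Implicit Types (N : 'rV[R]_d -> R) (P : probability (borel_rV R d) R).

Definition is_norm N : Prop :=
  [/\ forall x y, N (x + y) <= N x + N y,
      forall (c : R) x, N (c *: x) = `|c| * N x &
      forall x, N x = 0 -> x = 0].

Definition cballN N (x : 'rV[R]_d) (rho : R) : set (borel_rV R d) :=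
  [set y : 'rV[R]_d | N (y - x) <= rho].

Definition distN N (x : 'rV[R]_d) (A : set 'rV[R]_d) : R :=
  inf [set N (x - a) | a in A].

Definition distortion N P (p : R) (A : set 'rV[R]_d) : \bar R :=
  (\int[P]_x (distN N x A `^ p)%:E)%E.

Definition optimal_quantizer N P (r : R) (n : nat) (alpha : set 'rV[R]_d) :
    Prop :=
  [/\ alpha !=set0, (alpha #<= `I_n)%card &
      forall beta : set 'rV[R]_d, beta !=set0 -> (beta #<= `I_n)%card ->
        (distortion N P r alpha <= distortion N P r beta)%E].

(* In \bar R, 0^-1 = +oo and 0 * +oo = 0: hence 0 / 0 = 0 (which occurs at
   t = 0), and c / 0 = +oo for c > 0. *)
Definition sup_ratio N P (tau : R) (x : 'rV[R]_d) : \bar R :=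
  ereal_sup [set (lebesgue_rV R d (cballN N x t) / P (cballN N x t))%E
            | t in `[0, tau]%classic].

End quantization.

(* Main.v *)
Require Import Defs.
From HB Require Import structures.
From mathcomp Require Import all_boot all_order all_algebra.
From mathcomp Require Import all_classical all_reals all_analysis.
From mathcomp Require Import measurable_realfun ring lra.

Set Implicit Arguments.
Unset Strict Implicit.
Unset Printing Implicit Defensive.

Import Order.TTheory GRing.Theory Num.Theory.
Import numFieldNormedType.Exports.

Local Open Scope classical_set_scope.
Local Open Scope ring_scope.

(** The proof bounds [rho = d(y, alpha_n)] at every point [y] by the mass of a
    small ball around [y], the _local mass inequality_ [optimal_local_mass]:
    [rho^r P(B(y, b rho)) <= C n^(-1-r/d)] for [b <= 1/4].

    It comes from an exchange. Adding [y] to [alpha_n] lowers the distortion by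
    at least a multiple of the left-hand side, because the points of the ball
    are at distance at least [3 rho / 4] from [alpha_n]; so, by optimality,
    removing any node costs at least as much. The cost of removing the node [a]
    only concerns the points nearest to [a], which can be sent to a neighbour of
    [a]. Averaged over a set [G] of nodes which have a neighbour within [D], the
    cost is at most of the order of [(e_n + D^r) / |G|] ([exchange_optimal]),
    where [e_n] is the optimal distortion. Three facts make this quantity
    [O(n^(-1-r/d))]:
    - [e_n = O(n^(-r/d))] ([optimal_distortion_le]), which follows from the moment
      of order [r + delta] and an explicit product quantizer;
    - a positive fraction of the nodes stays in a bounded region, since otherwise
      the absolutely continuous part of [P] would make [e_n] too large
      ([optimal_quantizer_count]);
    - among these nodes a positive fraction has a neighbour within
      [D = O(n^(-1/d))], by the pigeonhole principle in a grid
      ([optimal_quantizer_neighbors]).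

    The integral of [d(x, alpha_n)^s] is then split at a large radius. Far from
    the origin, [b rho <= 2 b |x|], and since balls of radius [t] have volume at
    least [c t^d], the local mass inequality reads
    [(n^(1/d) rho)^(d+r) <= C sup_ratio] ([sup_ratio_ge]): raised to the power
    [s/(d+r)], it reduces this part to the hypothesis. In a bounded region the
    points at distance at least [u] from [alpha_n] are covered by [O(u^(-d))]
    balls to which the inequality applies, so that they have mass
    [O((n^(1/d) u)^(-(d+r)))] ([far_points_tail]), and summing over dyadic [u]
    converges as [s < d + r] ([bounded_distortion_le]). *)

(** * Integration and absolute continuity *)

Section measure_generalities.
Local Open Scope ereal_scope.
Context (disp : measure_display) (T : measurableType disp) (R : realType).
Implicit Types (mu nu : {measure set T -> \bar R}).

(** The integral of a nonnegative function is a supremum over the simple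
    functions below it, hence monotone on all functions. This form applies to
    suprema of uncountable families such as [sup_ratio]. *)
Lemma ge0_le_integral_nonmeasurable mu (f g : T -> \bar R) :
  (forall x, 0 <= f x) -> (forall x, f x <= g x) ->
  \int[mu]_x f x <= \int[mu]_x g x.
Proof.
move=> f0 fg; have g0 x : 0 <= g x by exact: le_trans (fg x).
rewrite !ge0_integralTE//; apply: ereal_sup_le => _ [h hf <-].
by exists h => // x; exact: le_trans (hf x) (fg x).
Qed.

(** Otherwise there would be sets [B k] with [mu (B k) <= 2^(-k-1)] and
    [nu (B k) > e]; their limit superior is [mu]-null, yet it has [nu]-measure at
    least [e]. *)
Lemma null_dominates_eps_delta mu nu : nu `<< mu -> nu setT < +oo ->
  forall e : R, (0 < e)%R -> exists2 a : R, (0 < a)%R &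
    forall B, measurable B -> mu B <= a%:E -> nu B <= e%:E.
Proof.
move=> /null_content_dominatesP dom nufin e e0; apply: contrapT => /forall2NP noa.
have /choice[B HB] k : exists B, [/\ measurable B,
    mu B <= (1 / (2 ^ k.+1)%:R)%:E & e%:E < nu B].
  have [|/existsNP[B /not_implyP[mB /not_implyP[muB /negP]]]] :=
    noa (1 / (2 ^ k.+1)%:R)%R.
    by rewrite divr_gt0// ltr0n expn_gt0.
  by rewrite -ltNge => nuB; exists B.
have mB k : measurable (B k) by case: (HB k).
have mu0 : mu (lim_sup_set B) = 0.
  apply: lim_sup_set_cvg0 => //; apply: le_lt_trans (ltry 1).
  apply: le_trans (epsilon_trick0 xpredT ler01).
  by apply: lee_nneseries => // k _; case: (HB k).
have nu0 : nu (lim_sup_set B) = 0.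
  apply: dom mu0; rewrite /lim_sup_set; apply: bigcapT_measurable => k.
  exact: bigcup_measurable.
have := @lim_sup_set_cvg _ _ _ nu B mB.
rewrite nu0 => cvg0.
have: e%:E <= 0; last by rewrite lee_fin leNgt e0.
have cvgB := cvg0 (le_lt_trans (le_measure _ _ _ (@subsetT _ _)) nufin).
rewrite -(cvg_lim _ (cvgB _ _)) ?inE//; last exact: bigcup_measurable.
apply: lime_ge.
  apply/cvg_ex; exists 0; apply: cvgB; rewrite inE//; exact: bigcup_measurable.
apply: nearW => n; have [_ _ /ltW le_e] := HB n.
apply: le_trans le_e _; apply: le_measure; rewrite ?inE//.
  exact: bigcup_measurable.
by move=> x Bx; exists n => //=.
Qed.

End measure_generalities.

(** * Norms, distances and volumes of balls *)

Section norm.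
Context {R : realType} {d : nat} (N : 'rV[R]_d -> R) (hN : is_norm N).
Implicit Types (x y : 'rV[R]_d) (A : set 'rV[R]_d).

Lemma is_norm0 : N 0 = 0.
Proof. by case: hN => _ /(_ 0 0) + _; rewrite scale0r normr0 mul0r. Qed.

Lemma is_normN x : N (- x) = N x.
Proof. by case: hN => _ /(_ (-1) x) + _; rewrite scaleN1r normrN1 mul1r. Qed.

Lemma is_norm_distC x y : N (x - y) = N (y - x).
Proof. by rewrite -is_normN opprB. Qed.

Lemma is_normD x y : N (x + y) <= N x + N y.
Proof. by case: hN. Qed.

Lemma is_norm_triangle y x z : N (x - z) <= N (x - y) + N (y - z).
Proof. by have := is_normD (x - y) (y - z); rewrite addrA subrK. Qed.

Lemma is_norm_ge0 x : 0 <= N x.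
Proof.
by have := is_normD x (- x); rewrite subrr is_norm0 is_normN; lra.
Qed.

(** On a finite-dimensional space [N] is bounded by the sup norm because it is
    so on the canonical basis. *)
Lemma is_norm_le_norm : exists2 c : R, 0 < c & forall x, N x <= c * `|x|.
Proof.
exists (\sum_j N (delta_mx ord0 j) + 1).
  by apply: ltr_wpDl => //; apply: sumr_ge0 => j _; exact: is_norm_ge0.
move=> x; apply: (@le_trans _ _ (\sum_j N (x ord0 j *: delta_mx ord0 j))).
  rewrite [in leLHS](row_sum_delta x).
  elim/big_ind2 : _ => [|a b a' b' ab ab'|//]; first by rewrite is_norm0.
  by apply: le_trans (is_normD _ _) _; exact: lerD.
rewrite mulrDl mul1r ler_wpDr// mulr_suml; apply: ler_sum => j _.
case: hN => _ -> _; rewrite mulrC ler_wpM2l ?is_norm_ge0//.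
rewrite [leRHS]/Num.norm /= mx_normrE.
exact: (le_bigmax _ (fun ij => `|x ij.1 ij.2|) (ord0, j)).
Qed.

Lemma is_norm_lip x y : `|N x - N y| <= N (x - y).
Proof.
rewrite ler_norml; have := is_normD (x - y) y; have := is_normD (y - x) x.
by rewrite !subrK (is_norm_distC y x) => ? ?; apply/andP; split; lra.
Qed.

Lemma continuous_is_norm : continuous N.
Proof.
have [c c0 Nc] := is_norm_le_norm.
move=> x B /= /(nbhs_ballP (N x))[e /= e0 eB].
apply/nbhs_ballP; exists (e / c) => /=; first by rewrite divr_gt0.
move=> y; rewrite -ball_normE /= ltr_pdivlMr// mulrC => xy; apply: eB.
exact: le_lt_trans (is_norm_lip x y) (le_lt_trans (Nc _) xy).
Qed.

(** On the compact unit sphere of the sup norm the continuous function [N] stays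
    away from 0. *)
Lemma norm_le_is_norm : exists2 c : R, 0 < c & forall x, `|x| <= c * N x.
Proof.
pose S := [set x : 'rV[R]_d | `|x| = 1].
have cS : compact S.
  apply: bounded_closed_compact.
    by exists 1; split => // M M1 x /= ->; exact: ltW.
  rewrite (_ : S = Num.norm @^-1` [set (1 : R)])//.
  apply: closed_comp => [x _|]; last exact: closed_eq.
  exact: norm_continuous.
have : closed (N @` S).
  apply: compact_closed; first exact: Rhausdorff.
  by apply: continuous_compact cS; exact/continuous_subspaceT/continuous_is_norm.
rewrite -openC => oS.
have /(nbhs_ballP (0 : R))[] : nbhs (0 : R) (~` (N @` S)).
  apply: open_nbhs_nbhs; split => // -[x Sx Nx0].
  have := Sx; case: hN => _ _ /(_ x Nx0) ->.
  by rewrite /S /= normr0 => /esym/eqP; rewrite oner_eq0.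
move=> e /= e0 eS; exists e^-1; first by rewrite invr_gt0.
move=> x; rewrite -ler_pdivrMl ?invr_gt0// invrK.
have [->|x0] := eqVneq x 0; first by rewrite normr0 mulr0 is_norm_ge0.
have nx0 : 0 < `|x| by rewrite normr_gt0.
rewrite leNgt; apply/negP => Nxe.
apply: (eS (N (`|x|^-1 *: x))).
  rewrite /ball /= sub0r normrN ger0_norm ?is_norm_ge0//; case: hN => _ -> _.
  by rewrite ger0_norm ?invr_ge0// mulrC ltr_pdivrMr.
exists (`|x|^-1 *: x) => //; rewrite /S /= normrZ ger0_norm ?invr_ge0//.
by rewrite mulVf// gt_eqF.
Qed.

Lemma distN_lbound x A : has_lbound [set N (x - a) | a in A].
Proof. by exists 0 => _ [a _ <-]; exact: is_norm_ge0. Qed.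

Lemma distN_le x A a : A a -> distN N x A <= N (x - a).
Proof. by move=> Aa; apply: ge_inf; [exact: distN_lbound|exists a]. Qed.

Lemma distN_ge0 x A : 0 <= distN N x A.
Proof.
have [->|/set0P[a Aa]] := eqVneq A set0; first by rewrite /distN image_set0 inf0.
by apply: lb_le_inf; [exists (N (x - a)), a|move=> _ [b _ <-]; exact: is_norm_ge0].
Qed.

Lemma distN_lip x y A : A !=set0 -> distN N x A <= distN N y A + N (x - y).
Proof.
move=> [a Aa]; rewrite -lerBlDr; apply: lb_le_inf; first by exists (N (y - a)), a.
move=> _ [b Ab <-]; have := distN_le x Ab; have := is_norm_triangle y x b; lra.
Qed.

(** The ratio 1/4 makes the gain of a new node at [y] positive: the points of the
    ball come closer, from at least 3/4 to at most 1/4 of [distN N y A]. *)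
Lemma distN_ball_ge x y A (b : R) : A !=set0 -> b <= 4^-1 ->
  cballN N y (b * distN N y A) x -> 3/4 * distN N y A <= distN N x A.
Proof.
rewrite /cballN /= => A0 b4 xy; have := distN_lip y x A0.
have := ler_wpM2r (distN_ge0 y A) b4.
by rewrite (is_norm_distC y x); lra.
Qed.

Lemma distN_attained x (s : seq 'rV[R]_d) : s != [::] ->
  exists2 a, a \in s & distN N x [set` s] = N (x - a).
Proof.
case: s => // b s _.
have [a [as_ amin]] : exists a, a \in b :: s /\
    forall a', a' \in b :: s -> N (x - a) <= N (x - a').
  elim: s b => [b|c s ih b].
    by exists b; rewrite mem_seq1; split=> // a'; rewrite mem_seq1 => /eqP ->.
  have [a [as_ amin]] := ih c.
  have [ba|ab] := leP (N (x - b)) (N (x - a)).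
    exists b; rewrite mem_head; split => // a'; rewrite inE => /predU1P[->//|].
    by move=> /amin; exact: le_trans.
  exists a; rewrite inE as_ orbT; split => // a'; rewrite inE => /predU1P[->|].
    exact: ltW.
  exact: amin.
exists a => //; apply/eqP; rewrite eq_le distN_le//=.
apply: lb_le_inf; first by exists (N (x - a)), a.
by move=> _ [a' /= /amin + <-].
Qed.

(** Lipschitz functions for [N] are continuous, hence Borel. *)
Lemma measurable_lip (f : 'rV[R]_d -> R) :
  (forall x y, f x <= f y + N (x - y)) ->
  measurable_fun [set: borel_rV R d] (f : borel_rV R d -> R).
Proof.
move=> flip; have [c c0 Nc] := is_norm_le_norm.
have := @measurability _ _ (borel_rV R d) (measurableTypeR R) setT f
  _ (RGenOInfty.measurableE R).
apply.
move=> _ [_ [a ->] <-]; rewrite setTI; apply: sub_sigma_algebra.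
rewrite /= openE => x /=; rewrite in_itv /= andbT => afx.
apply/nbhs_ballP; exists ((f x - a) / c) => /=.
  by rewrite divr_gt0// subr_gt0.
move=> y; rewrite -ball_normE /= in_itv/= andbT ltr_pdivlMr// mulrC => xy.
by have := flip x y; have := Nc (x - y); lra.
Qed.

Lemma measurable_distN A : A !=set0 ->
  measurable_fun [set: borel_rV R d] (fun x : borel_rV R d => distN N x A : R).
Proof. by move=> A0; apply: measurable_lip => x y; exact: distN_lip. Qed.

Lemma measurable_is_normB y :
  measurable_fun [set: borel_rV R d] (fun x : borel_rV R d => N (x - y) : R).
Proof.
by apply: measurable_lip => x z; rewrite [leRHS]addrC; exact: is_norm_triangle.
Qed.

Lemma measurable_is_norm :
  measurable_fun [set: borel_rV R d] (N : borel_rV R d -> R).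
Proof.
by apply: measurable_lip => x y; have := is_normD (x - y) y; rewrite subrK addrC.
Qed.

Lemma measurable_cballN x t : measurable (cballN N x t).
Proof.
have -> : cballN N x t = (fun y : borel_rV R d => N (y - x)) @^-1` `]-oo, t].
  by apply/seteqP; split => y; rewrite /cballN /= in_itv.
by rewrite -[X in measurable X]setTI; exact: measurable_is_normB.
Qed.

Lemma cballN_le x t u : t <= u -> cballN N x t `<=` cballN N x u.
Proof. by move=> tu y; rewrite /cballN /= => /le_trans; exact. Qed.

Lemma lebesgue_cballN_ge : exists2 c : R, 0 < c & forall x t, 0 <= t ->
  ((c * t `^ d%:R)%:E <= lebesgue_rV R d (cballN N x t))%E.
Proof.
have [c c0 Nc] := is_norm_le_norm.
exists ((2 / c) ^+ d) => [|x t t0]; first by rewrite exprn_gt0// divr_gt0.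
have tc : 0 <= t / c by rewrite divr_ge0// ltW.
have ab i : (x - const_mx (t / c)) ord0 i <= (x + const_mx (t / c)) ord0 i.
  by rewrite !mxE; lra.
apply: (@le_trans _ _ (lebesgue_rV R d
    (box_rV (x - const_mx (t / c)) (x + const_mx (t / c))))).
  rewrite (lebesgue_rV_box ab) lee_fin powR_mulrn// -exprMn.
  rewrite (eq_bigr (fun=> 2 / c * t)); last by move=> i _; rewrite !mxE; field; rewrite gt_eqF.
  by rewrite prodr_const card_ord.
apply: le_measure; rewrite ?inE; [exact: measurable_box_rV|
  exact: measurable_cballN|].
move=> y /= xy; rewrite /cballN /=; apply: le_trans (Nc _) _.
rewrite mulrC -ler_pdivlMr// [leLHS]/Num.norm /= mx_normrE.
apply/bigmax_leP; split=> // -[i j] _ /=; rewrite (ord1 i) !mxE ler_norml.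
by have := xy j; rewrite !mxE => /andP[? ?]; apply/andP; split; lra.
Qed.

Lemma lebesgue_cballN_le : exists2 c : R, 0 < c & forall x t, 0 <= t ->
  (lebesgue_rV R d (cballN N x t) <= (c * t `^ d%:R)%:E)%E.
Proof.
have [c c0 cN] := norm_le_is_norm.
exists ((2 * c) ^+ d) => [|x t t0]; first by rewrite exprn_gt0// mulr_gt0.
have tc : 0 <= c * t by rewrite mulr_ge0// ltW.
have ab i : (x - const_mx (c * t)) ord0 i <= (x + const_mx (c * t)) ord0 i.
  by rewrite !mxE; lra.
apply: (@le_trans _ _ (lebesgue_rV R d
    (box_rV (x - const_mx (c * t)) (x + const_mx (c * t))))); last first.
  rewrite (lebesgue_rV_box ab) lee_fin powR_mulrn// -exprMn.
  rewrite (eq_bigr (fun=> 2 * c * t)); last by move=> i _; rewrite !mxE; ring.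
  by rewrite prodr_const card_ord.
apply: le_measure; rewrite ?inE; [exact: measurable_cballN|
  exact: measurable_box_rV|].
move=> y /= xy i; rewrite !mxE.
have : `|(y : 'rV[R]_d) ord0 i - x ord0 i| <= c * t.
  apply: le_trans (le_trans (cN (y - x)) _); last by rewrite ler_wpM2l// ltW.
  rewrite [leRHS]/Num.norm /= mx_normrE.
  have := le_bigmax 0 (fun ij => `|((y : 'rV[R]_d) - x) ij.1 ij.2|) (ord0, i).
  by rewrite /= !mxE.
by rewrite ler_norml => /andP[? ?]; apply/andP; split; lra.
Qed.

End norm.

(** * Finite sets and grids *)

Section finite_sets.
Context (T : choiceType).

Lemma card_le_seq (s : seq T) : ([set` s] #<= `I_(size s))%card.
Proof.
case: s => [|a s]; first by rewrite set_nil card_ge0.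
apply: card_le_trans (card_image_le (nth a (a :: s)) `I_(size (a :: s))).
apply: subset_card_le => x xs; exists (index x (a :: s)).
  by have : x \in a :: s := xs; rewrite -index_mem.
exact: nth_index.
Qed.

Lemma card_le_uniq_seq n (A : set T) : (A #<= `I_n)%card ->
  exists s : seq T, [/\ uniq s, (size s <= n)%N & A = [set` s]].
Proof.
move=> An; have finA : finite_set A by apply/finite_set_leP; exists n.
exists (finmap.enum_fset (fset_set A)); split; [exact: finmap.fset_uniq|exact: geq_card_fset_set|].
by apply/seteqP; split => x; rewrite /= in_fset_set// inE.
Qed.

End finite_sets.

Section grid.
Context {R : realType} {d : nat} (N : 'rV[R]_d -> R) (hN : is_norm N).

Lemma sup_norm_grid (K : R) (L : nat) : 0 < K -> (0 < L)%N ->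
  exists cell : 'rV[R]_d -> {ffun 'I_d -> 'I_L.+1}, forall x y,
    `|x| <= K -> `|y| <= K -> cell x = cell y -> `|x - y| <= 2 * K / L%:R.
Proof.
move=> K0 L0; have L0' : (0 : R) < L%:R by rewrite ltr0n.
pose t (x : 'rV[R]_d) j := (x ord0 j + K) / (2 * K) * L%:R.
have tK x j : `|x| <= K -> 0 <= t x j <= L%:R.
  move=> xK; have : `|x ord0 j| <= K.
    apply: le_trans xK; rewrite [leRHS]/Num.norm /= mx_normrE.
    exact: (le_bigmax _ (fun ij => `|x ij.1 ij.2|) (ord0, j)).
  rewrite ler_norml => /andP[xK1 xK2]; apply/andP; split.
    by rewrite !mulr_ge0// ?invr_ge0; lra.
  by rewrite ler_piMl ?ler0n// ler_pdivrMr; lra.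
exists (fun x => [ffun j => inord (Num.truncn (t x j))]) => x y xK yK /ffunP xy.
rewrite [leLHS]/Num.norm /= mx_normrE; apply/bigmax_leP; split.
  by rewrite divr_ge0//; lra.
move=> -[i j] _ /=; rewrite (ord1 i) !mxE.
have [tx0 txL] := andP (tK x j xK); have [ty0 tyL] := andP (tK y j yK).
have trL u : 0 <= u <= L%:R -> (Num.truncn (u : R) < L.+1)%N.
  by move=> /andP[u0 uL]; rewrite ltnS -(ler_nat R) (le_trans _ uL)// truncn_le.
have : Num.truncn (t x j) = Num.truncn (t y j).
  have := xy j; rewrite !ffunE => /(congr1 (@nat_of_ord _)).
  by rewrite !inordK ?trL ?tx0 ?ty0.
move=> txy; have /andP[x1 x2] := truncn_itv tx0; have /andP[y1 y2] := truncn_itv ty0.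
rewrite txy in x1 x2; rewrite -natr1 in x2 y2.
have -> : x ord0 j - y ord0 j = (t x j - t y j) * (2 * K / L%:R).
  by rewrite /t; field; rewrite !gt_eqF.
rewrite normrM [X in _ * X]ger0_norm; last by rewrite divr_ge0//; lra.
rewrite ler_piMl//; first by rewrite divr_ge0//; lra.
by rewrite ler_norml; apply/andP; split; lra.
Qed.

(** The constant absorbs the comparison of [N] with the sup norm. *)
Lemma norm_grid : exists2 c : R, 0 < c & forall (K : R) (L : nat),
  0 < K -> (0 < L)%N ->
  exists cell : 'rV[R]_d -> {ffun 'I_d -> 'I_L.+1}, forall x y,
    N x <= K -> N y <= K -> cell x = cell y -> N (x - y) <= c * K / L%:R.
Proof.
have [c1 c10 Nc1] := is_norm_le_norm hN; have [c2 c20 c2N] := norm_le_is_norm hN.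
exists (2 * c1 * c2) => [|K L K0 L0]; first by rewrite !mulr_gt0.
have c2K : 0 < c2 * K by rewrite mulr_gt0.
have [cell cellP] := sup_norm_grid c2K L0.
exists cell => x y xK yK xy; apply: le_trans (Nc1 _) _.
have le_K z : N z <= K -> `|z| <= c2 * K.
  by move=> zK; apply: le_trans (c2N z) _; rewrite ler_pM2l.
rewrite (_ : 2 * _ * _ * _ / _ = c1 * (2 * (c2 * K) / L%:R)); last by ring.
by rewrite ler_pM2l//; apply: cellP => //; exact: le_K.
Qed.

(** Points without a close neighbour lie in distinct cells of the grid, so all
    but [L.+1 ^ d] points have one. *)
Lemma pigeonhole_neighbors : exists2 c : R, 0 < c &
  forall (K : R) (L : nat) (s : seq 'rV[R]_d), 0 < K -> (0 < L)%N -> uniq s ->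
    (forall a, a \in s -> N a <= K) ->
    (size s <= size [seq a <- s | has (fun b => (b != a) &&
                        (N (a - b) <= c * K / L%:R)%R) s] + L.+1 ^ d)%N.
Proof.
have [c c0 gridc] := norm_grid; exists c => // K L s K0 L0 us sK.
have [cell cellP] := gridc K L K0 L0.
set p := (fun a => has _ s); rewrite -(count_predC p s) size_filter leq_add2l.
have <- : #|{ffun 'I_d -> 'I_L.+1}| = (L.+1 ^ d)%N by rewrite card_ffun !card_ord.
rewrite -size_filter -(size_map cell) -(card_uniqP _); first exact: max_card.
rewrite map_inj_in_uniq ?filter_uniq// => a b; rewrite !mem_filter /= => /andP[npa as_].
move=> /andP[_ bs] ab; apply/eqP; rewrite eq_sym; apply: contraNT npa => ba.
by apply/hasP; exists b => //; rewrite ba/= cellP// sK.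
Qed.

End grid.

Section measure_cover.
Local Open Scope ereal_scope.
Context (disp : measure_display) (T : measurableType disp) (R : realType)
  (mu : {measure set T -> \bar R}).

Lemma measure_bigsetU_le (I : Type) (s : seq I) (F : I -> set T) :
  (forall i, measurable (F i)) ->
  mu (\big[setU/set0]_(i <- s) F i) <= \sum_(i <- s) mu (F i).
Proof.
move=> mF; elim: s => [|a s ih]; first by rewrite !big_nil measure0.
rewrite !big_cons; apply: le_trans (measureU2 _ _ _) _ => //.
  exact: bigsetU_measurable.
exact: leeD2l.
Qed.

End measure_cover.

Section grid_measure.
Local Open Scope ereal_scope.
Context {R : realType} {d : nat} (N : 'rV[R]_d -> R) (hN : is_norm N).

(** A bounded set on which all small balls are light is itself light: choose a
    center in each cell of the grid which the set meets. *)
Lemma measure_le_grid : exists2 c : R, (0 < c)%R &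
  forall (mu : {measure set (borel_rV R d) -> \bar R}) (K p : R) (L : nat)
    (S : set (borel_rV R d)),
    (0 < K)%R -> (0 < L)%N -> (0 <= p)%R -> measurable S ->
    (forall x, S x -> (N x <= K)%R) ->
    (forall x, S x -> mu (cballN N x (c * K / L%:R)) <= p%:E) ->
    mu S <= ((L.+1 ^ d)%:R * p)%:E.
Proof.
have [c c0 gridc] := norm_grid hN; exists c => // mu K p L S K0 L0 p0 mS SK Sp.
have [cell cellP] := gridc K L K0 L0.
pose F k : set (borel_rV R d) :=
  if pselect (exists x : 'rV[R]_d, S x /\ cell x = k) is left e then
    cballN N (sval (cid e)) (c * K / L%:R) else set0.
have mF k : measurable (F k).
  by rewrite /F; case: pselect => // e; exact: measurable_cballN.
pose I : finType := {ffun 'I_d -> 'I_L.+1}.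
have SF : S `<=` \big[setU/set0]_(k <- enum I) F k.
  move=> x Sx; rewrite -bigcup_seq; exists (cell x); first by rewrite /= mem_enum.
  rewrite /F; case: pselect => [e|[]]; last by exists x.
  have [Se xe] := svalP (cid e).
  by rewrite /cballN /=; apply: cellP; rewrite ?SK.
apply: (@le_trans _ _ (mu (\big[setU/set0]_(k <- enum I) F k))).
  by apply: le_measure => //; rewrite inE//; exact: bigsetU_measurable.
apply: le_trans (measure_bigsetU_le _ _ mF) _.
apply: (@le_trans _ _ (\sum_(k <- enum I) p%:E)).
  apply: lee_sum => k _; rewrite /F; case: pselect => [e|_].
    by apply: Sp; have [] := svalP (cid e).
  by rewrite measure0 lee_fin.
by rewrite big_enum/= sumEFin sumr_const card_ffun !card_ord mulr_natl.
Qed.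

End grid_measure.

(** * Real powers *)

Section power_inequalities.
Context {R : realType}.
Implicit Types a b p : R.

Lemma ler_powR2r p a b : 0 <= p -> 0 <= a -> a <= b -> a `^ p <= b `^ p.
Proof.
by move=> p0 a0 ab; apply: ge0_ler_powR => //; rewrite nnegrE//; exact: le_trans ab.
Qed.

Lemma powR_le1 p a : 0 <= p -> 0 <= a <= 1 -> a `^ p <= 1.
Proof. by move=> p0 /andP[a0 /(ler_powR2r p0 a0)]; rewrite powR1. Qed.

Lemma powRXn a p k : 0 <= a -> (a ^+ k) `^ p = (a `^ p) ^+ k.
Proof. by move=> a0; rewrite -(powR_mulrn k a0) powRAC powR_mulrn ?powR_ge0. Qed.

Lemma powRV a p : 0 <= a -> a^-1 `^ p = (a `^ p)^-1.
Proof. by move=> a0; rewrite -(powR_inv1 a0) powRAC powR_inv1 ?powR_ge0. Qed.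

Lemma powRD_le p a b : 0 <= p -> 0 <= a -> 0 <= b ->
  (a + b) `^ p <= 2 `^ p * (a `^ p + b `^ p).
Proof.
move=> p0 a0 b0; wlog ab : a b a0 b0 / a <= b => [hw|].
  by have [/hw->//|/ltW/hw] := leP a b; rewrite addrC [b `^ _ + _]addrC => ->.
apply: (@le_trans _ _ ((2 * b) `^ p)); first by apply: ler_powR2r; lra.
by rewrite powRM// ler_wpM2l ?powR_ge0// lerDr powR_ge0.
Qed.

Lemma nat_between_third (q : R) : 2 <= q -> exists L : nat,
  [/\ (0 < L)%N, L.+1%:R <= q & q <= 3 * L%:R].
Proof.
move=> q2; have q0 : 0 <= q by lra.
have /andP[t1 t2] := truncn_itv q0.
have tq : (2 <= Num.truncn q)%N by rewrite truncn_ge_nat.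
exists (Num.truncn q).-1; case: (Num.truncn q) tq t1 t2 => [|[|m]]// _ t1 t2.
split => //=; move: t2; rewrite -![_.+1%:R]natr1.
by have := ler0n R m; lra.
Qed.

End power_inequalities.

(** * Quantizers adapted to a moment *)

Section pierce.
Context {R : realType}.

(** The [j]-th node is [phi (j / m)] with [phi t = (1 - t)^(-1/g) - 1]. As
    [phi' = (1 + phi)^(1 + g) / g] is increasing, the node next to [y] on its left
    is at distance at most [(1 + y)^(1 + g) / (g m)] from [y]. And [phi] maps
    [[0, 1)] onto the whole half-line: even the unbounded cell of the last node
    obeys this bound. *)
Lemma halfline_quantizer (g : R) (m : nat) (y : R) : 0 < g -> (0 < m)%N -> 0 <= y ->
  exists2 j, (j < m)%N &
    `|y - (expR (- ln (1 - j%:R / m%:R) / g) - 1)| <= (g * m%:R)^-1 * (1 + y) `^ (1 + g).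
Proof.
move=> g0 m0 y0; have m0' : (0 : R) < m%:R by rewrite ltr0n.
have y1 : 0 < 1 + y by lra.
(* [y = phi t], in logarithmic coordinates: [X = ln (1 + y)], and [Y] plays
   the same role for the node. *)
pose X := ln (1 + y); have eX : expR X = 1 + y by rewrite lnK// posrE.
pose t := 1 - expR (- (g * X)).
have X0 : 0 <= X by apply: ln_ge0; lra.
have t1 : t < 1 by rewrite /t; have := expR_gt0 (- (g * X)); lra.
have t0 : 0 <= t by rewrite subr_ge0 -[leRHS]expR0 ler_expR oppr_le0 mulr_ge0// ltW.
have mt0 : 0 <= m%:R * t by rewrite mulr_ge0// ltW.
have /andP[j1 j2] := truncn_itv mt0.
set j := Num.truncn _ in j1 j2; have jm : (j < m)%N.
  by rewrite -(ltr_nat R) (le_lt_trans j1)// gtr_pMr.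
exists j => //; rewrite -natr1 in j2.
have jt : j%:R / m%:R <= t by rewrite ler_pdivrMr// mulrC.
have jt' : t - j%:R / m%:R <= m%:R^-1.
  rewrite -(@ler_pM2l _ m%:R)// mulrBr mulfV ?gt_eqF// mulrCA mulfV ?gt_eqF//.
  by lra.
pose Y := - ln (1 - j%:R / m%:R) / g.
have eY : expR (- (g * Y)) = 1 - j%:R / m%:R.
  by rewrite /Y mulrC divfK ?gt_eqF// opprK lnK// posrE; lra.
have XY : Y <= X.
  rewrite -(ler_pM2l g0) -lerN2 -ler_expR eY; move: jt; rewrite /t; lra.
have eXY : g * (X - Y) * expR (- (g * X)) <= m%:R^-1.
  have -> : expR (- (g * X)) = 1 - t by rewrite /t; lra.
  have := expR_ge1Dx (g * (X - Y)).
  have : expR (g * (X - Y)) * (1 - t) = 1 - j%:R / m%:R.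
    rewrite -eY [1 - t](_ : _ = expR (- (g * X))); last by rewrite /t; lra.
    by rewrite -expRD; congr expR; ring.
  move=> E /(ler_wpM2r (_ : 0 <= 1 - t)); rewrite E => h.
  by have := h ltac:(lra); lra.
have yE : y - (expR Y - 1) = expR X - expR Y by rewrite eX; ring.
rewrite -/Y yE ger0_norm; last by rewrite subr_ge0 ler_expR.
have -> : (1 + y) `^ (1 + g) = expR X * expR (g * X).
  by rewrite /powR gt_eqF// -expRD mulrDl mul1r.
apply: (@le_trans _ _ (expR X * (X - Y))).
  have -> : expR Y = expR X * expR (Y - X) by rewrite -expRD; congr expR; ring.
  have := ler_wpM2l (expR_ge0 X) (expR_ge1Dx (Y - X)); lra.
rewrite mulrCA ler_pM2l ?expR_gt0// mulrC -ler_pdivrMl ?expR_gt0// -expRN.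
rewrite invfM mulrC ler_pdivlMl//; move: eXY; lra.
Qed.

Context {d : nat} (N : 'rV[R]_d -> R) (hN : is_norm N).

(** For the sup norm, the points all of whose coordinates are nodes of the
    symmetrized half-line quantizer do the job. *)
Lemma product_quantizer (g : R) : 0 < g -> exists2 c : R, 0 < c &
  forall m, (0 < m)%N -> exists s : seq 'rV[R]_d,
    [/\ s != [::], (size s = (2 * m) ^ d)%N &
      forall x, distN N x [set` s] <= c / m%:R * (1 + N x) `^ (1 + g)].
Proof.
move=> g0; have [c1 c10 Nc1] := is_norm_le_norm hN.
have [c2 c20 c2N] := norm_le_is_norm hN.
have c2g : 0 < (1 + c2) `^ (1 + g) by apply: powR_gt0; lra.
exists (c1 / g * (1 + c2) `^ (1 + g)); first by rewrite mulr_gt0// divr_gt0.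
move=> m m0; have m0' : (0 : R) < m%:R by rewrite ltr0n.
pose I : finType := {ffun 'I_d -> bool * 'I_m}.
pose node (k : bool * 'I_m) : R :=
  (-1) ^+ k.1 * (expR (- ln (1 - k.2%:R / m%:R) / g) - 1).
pose F (f : I) : 'rV[R]_d := \row_j node (f j).
have sizeF : size (map F (enum I)) = ((2 * m) ^ d)%N.
  by rewrite size_map -cardE card_ffun card_prod card_bool !card_ord.
exists (map F (enum I)); split => //.
  by rewrite -size_eq0 sizeF -lt0n expn_gt0 muln_gt0 m0.
move=> x.
have /choice[k kP] : forall j, exists k, `|x ord0 j - node k| <=
    (g * m%:R)^-1 * (1 + `|x ord0 j|) `^ (1 + g).
  move=> j; have [i im iP] := halfline_quantizer g0 m0 (normr_ge0 (x ord0 j)).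
  exists (x ord0 j < 0, Ordinal im); rewrite /node /=; apply: le_trans iP.
  have [x0|x0] := ltP; last by rewrite expr0 mul1r (ger0_norm x0).
  by rewrite expr1 mulN1r (ltr0_norm x0) -[leLHS]normrN [X in `|X|]opprD opprK.
have Fk : [set` map F (enum I)] (F [ffun j => k j]).
  by rewrite /= map_f// mem_enum.
apply: le_trans (distN_le hN x Fk) _.
apply: le_trans (Nc1 _) _.
rewrite [leRHS](_ : _ = c1 * ((g * m%:R)^-1 *
    ((1 + c2) `^ (1 + g) * (1 + N x) `^ (1 + g)))); last first.
  by rewrite invfM; ring.
rewrite ler_pM2l// [leLHS]/Num.norm /= mx_normrE.
have N0 := is_norm_ge0 hN x.
apply/bigmax_leP; split => [|[i j] _ /=].
  by rewrite !mulr_ge0// ?invr_ge0 ?powR_ge0// mulr_ge0// ltW.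
rewrite (ord1 i) !mxE ffunE; apply: le_trans (kP j) _.
rewrite ler_pM2l ?invr_gt0 ?mulr_gt0// -powRM; [|lra|lra].
apply: ler_powR2r; rewrite ?addr_ge0//; first by rewrite ltW.
have : `|x ord0 j| <= c2 * N x.
  apply: le_trans (c2N x); rewrite [leRHS]/Num.norm /= mx_normrE.
  exact: (le_bigmax _ (fun ij => `|x ij.1 ij.2|) (ord0, j)).
by nra.
Qed.

(** Every [n >= 2 ^ d] is within a constant factor of some [(2 m) ^ d] below it;
    for smaller [n] the origin alone suffices. *)
Lemma pierce_quantizer (hd : (0 < d)%N) (g : R) : 0 < g -> exists2 c : R, 0 < c &
  forall n, (0 < n)%N -> exists s : seq 'rV[R]_d,
    [/\ s != [::], (size s <= n)%N &
      forall x, distN N x [set` s] <=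
        c * n%:R `^ (- d%:R^-1) * (1 + N x) `^ (1 + g)].
Proof.
move=> g0; have [c c0 quant] := product_quantizer g0.
have d0 : (0 : R) < d%:R by rewrite ltr0n.
exists (4 * c + 2) => [|n n0]; first by lra.
have n0' : (0 : R) < n%:R by rewrite ltr0n.
pose q : R := n%:R `^ d%:R^-1.
have q0 : 0 < q by exact: powR_gt0.
have qd : q ^+ d = n%:R.
  by rewrite -powR_mulrn ?ltW// -powRrM mulVf ?gt_eqF// powRr1// ltW.
rewrite powRN -/q.
have [q2|q2] := leP 2 q; last first.
  exists [:: 0]; split => // x.
  have s0 : [set` [:: 0 : 'rV[R]_d]] 0 by rewrite /= mem_head.
  apply: le_trans (distN_le hN x s0) _.
  rewrite subr0; have N0 := is_norm_ge0 hN x.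
  apply: (@le_trans _ _ (1 + N x)); first by lra.
  apply: (@le_trans _ _ ((1 + N x) `^ (1 + g))).
    by apply: le1r_powR; lra.
  rewrite ler_peMl ?powR_ge0// -ler_pdivrMr ?invr_gt0// invrK mul1r; lra.
pose m := Num.truncn (q / 2).
have /andP[m1 m2] : m%:R <= q / 2 < m.+1%:R by apply: truncn_itv; lra.
have m0 : (0 < m)%N by rewrite /m truncn_gt0; lra.
clearbody m.
have m0' : (1 : R) <= m%:R by rewrite ler1n.
have [s [s0 sizes sP]] := quant m m0; exists s; split => //.
  rewrite sizes -(ler_nat R) -qd natrX natrM lerXn2r ?nnegrE//; lra.
move=> x; apply: le_trans (sP x) _; rewrite ler_wpM2r ?powR_ge0//.
rewrite -[m.+1%:R]natr1 in m2; rewrite ler_pdivrMr; last by lra.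
rewrite mulrAC ler_pdivlMr//.
have : c * q <= c * (4 * m%:R) by rewrite ler_pM2l//; lra.
lra.
Qed.

End pierce.

(** * Distortion of optimal quantizers *)

Section mesh.
Context {R : realType} {d : nat} (hd : (0 < d)%N).

(** The typical distance between [n] points filling a bounded region of R^d. *)
Definition mesh (n : nat) : R := n%:R `^ (- d%:R^-1).

Lemma mesh_gt0 n : (0 < n)%N -> 0 < mesh n.
Proof. by move=> n0; apply: powR_gt0; rewrite ltr0n. Qed.

Lemma mesh_powR_dim n : mesh n `^ d%:R = n%:R^-1.
Proof. by rewrite -powRrM mulNr mulVf ?pnatr_eq0 -?lt0n// powR_inv1. Qed.

Lemma mesh_le1 n : (0 < n)%N -> mesh n <= 1.
Proof.
move=> n0; rewrite -[leRHS](powRr0 n%:R); apply: ler_powR; first by rewrite ler1n.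
by rewrite oppr_le0 invr_ge0.
Qed.

End mesh.
Arguments mesh R d n : clear implicits.

Section distortion.
Local Open Scope ereal_scope.
Context {R : realType} {d : nat} (N : 'rV[R]_d -> R) (hN : is_norm N)
  (P : probability (borel_rV R d) R).

Lemma measurable_powR_fun (f : borel_rV R d -> R) (p : R) :
  measurable_fun setT f -> measurable_fun setT (fun x => (f x `^ p)%:E).
Proof.
move=> mf; apply/measurable_EFinP.
by have := measurableT_comp (@measurable_powR R p) mf.
Qed.

Lemma measurable_distN_powR (A : set 'rV[R]_d) (p : R) : A !=set0 ->
  measurable_fun [set: borel_rV R d] (fun x => (distN N x A `^ p)%:E).
Proof. by move=> A0; apply: measurable_powR_fun; exact: measurable_distN. Qed.

Lemma distortion_ge0 (p : R) (A : set 'rV[R]_d) : 0 <= distortion N P p A.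
Proof. by apply: integral_ge0 => x _; rewrite lee_fin powR_ge0. Qed.

Lemma probability_integral_cst (c : R) : \int[P]_x c%:E = c%:E.
Proof. by rewrite integral_cst// [X in _ * X]probability_setT mule1. Qed.

Lemma distortion_markov (p u : R) (A : set 'rV[R]_d) (S : set (borel_rV R d)) :
  measurable S -> (0 <= p)%R -> (0 <= u)%R -> (forall x, S x -> (u <= distN N x A)%R) ->
  (u `^ p)%:E * P S <= distortion N P p A.
Proof.
move=> mS p0 u0 uS; rewrite -(setIT S) -integral_indic// -ge0_integralZl_EFin ?powR_ge0//.
- apply: ge0_le_integral_nonmeasurable => x; rewrite -EFinM lee_fin.
    by rewrite mulr_ge0// powR_ge0.
  rewrite indicE; have [|_] := boolP (x \in S); rewrite ?mulr0 ?powR_ge0// inE mulr1.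
  by move=> /uS; exact: ler_powR2r.
- by apply/measurable_EFinP; exact: measurable_indic.
Qed.

Lemma local_mass_le_distortion (p b : R) (A : set 'rV[R]_d) (y : 'rV[R]_d) :
  (0 <= p)%R -> A !=set0 -> (b <= 4^-1)%R ->
  ((3/4) `^ p * distN N y A `^ p)%:E * P (cballN N y (b * distN N y A)) <=
  distortion N P p A.
Proof.
move=> p0 A0 b4; have D0 := distN_ge0 hN y A.
have r0 : (0 <= 3/4 * distN N y A)%R by rewrite mulr_ge0//; lra.
rewrite -powRM//; apply: distortion_markov => //; first exact: measurable_cballN.
by move=> x; exact: distN_ball_ge.
Qed.

End distortion.

Section optimal.
Local Open Scope ereal_scope.
Context {R : realType} {d : nat} (hd : (0 < d)%N)
  (N : 'rV[R]_d -> R) (hN : is_norm N)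
  (r : R) (hr : (0 < r)%R) (P : probability (borel_rV R d) R).

Lemma optimal_quantizer_le_seq n alpha (s : seq 'rV[R]_d) :
  optimal_quantizer N P r n alpha -> s != [::] -> (size s <= n)%N ->
  distortion N P r alpha <= distortion N P r [set` s].
Proof.
move=> [_ _ opt] s0 sn; apply: opt.
  by case: s s0 {sn} => // a s _; exists a; rewrite /= mem_head.
by apply: card_le_trans (card_le_seq s) _; rewrite card_le_II.
Qed.

Context (moment : exists2 delta : R, (0 < delta)%R &
    \int[P]_x (N x `^ (r + delta))%:E < +oo).

(** Pierce's lemma: with [g = delta / r], the [r]-th power of the error of
    [pierce_quantizer] is at most of the order of
    [n^(-r/d) (1 + N x)^(r + delta)], which is integrable. *)
Lemma optimal_distortion_le : exists2 C : R, (0 < C)%R & forall n alpha,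
  (0 < n)%N -> optimal_quantizer N P r n alpha ->
  distortion N P r alpha <= (C * mesh R d n `^ r)%:E.
Proof.
have [delta delta0 fin] := moment.
set I := \int[P]_x _ in fin.
have I0 : 0 <= I by apply: integral_ge0 => x _; rewrite lee_fin powR_ge0.
have If : I \is a fin_num by rewrite ge0_fin_numE.
have dr0 : (0 < delta / r)%R by rewrite divr_gt0.
have [c c0 quant] := pierce_quantizer hN hd dr0.
have rd0 : (0 < r + delta)%R by rewrite addr_gt0.
pose C2 : R := (2 `^ (r + delta))%R.
have C20 : (0 < C2)%R by exact: powR_gt0.
exists (c `^ r * C2 * (1 + fine I))%R.
  by rewrite !mulr_gt0 ?powR_gt0// ltr_wpDr// fine_ge0.
move=> n alpha n0 opt; have [s [s0 sn sP]] := quant n n0.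
apply: le_trans (optimal_quantizer_le_seq opt s0 sn) _.
have h0 := @mesh_gt0 R d n n0.
apply: (@le_trans _ _ (\int[P]_x ((c `^ r * C2 * mesh R d n `^ r)%:E *
    (1%:E + (N x `^ (r + delta))%:E)))).
  apply: ge0_le_integral_nonmeasurable => x; rewrite ?lee_fin ?powR_ge0//.
  have N0 := is_norm_ge0 hN x.
  apply: (@le_trans _ _ ((c * mesh R d n * (1 + N x) `^ (1 + delta / r)) `^ r)%R).
    by apply: ler_powR2r (sP x); [exact: ltW|exact: distN_ge0].
  rewrite powRM ?mulr_ge0 ?powR_ge0 ?(ltW c0)// powRM ?(ltW c0) ?powR_ge0//.
  rewrite -powRrM mulrDl mul1r divfK ?gt_eqF//.
  have := @powRD_le _ _ 1%R (N x) (ltW rd0) ler01 N0.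
  rewrite powR1 -/C2 => h.
  rewrite [leRHS](_ : _ = c `^ r * mesh R d n `^ r * (C2 * (1 + N x `^ (r + delta))))%R.
    by rewrite ler_wpM2l// mulr_ge0// powR_ge0.
  by ring.
have mN := measurable_powR_fun (r + delta) (measurable_is_norm hN).
rewrite ge0_integralZl_EFin//; first last.
- by rewrite !mulr_ge0// ?powR_ge0// ltW.
- exact: emeasurable_funD.
- by move=> x _; rewrite -EFinD lee_fin addr_ge0// powR_ge0.
rewrite ge0_integralD//; first last.
- by move=> x _; rewrite lee_fin powR_ge0.
rewrite probability_integral_cst -/I -(fineK If) -EFinD -EFinM lee_fin.
by rewrite [leLHS]mulrAC.
Qed.

(** The integrated triangle inequality bounds [d(0, alpha)] by the moment of [P]
    and the distortion, hence uniformly in the size. *)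
Lemma optimal_quantizer_bounded : exists2 M : R, (0 < M)%R & forall n alpha,
  (0 < n)%N -> optimal_quantizer N P r n alpha -> (distN N 0 alpha <= M)%R.
Proof.
have [C C0 distC] := optimal_distortion_le.
have [delta delta0 fin] := moment.
set I := \int[P]_x _ in fin.
have I0 : 0 <= I by apply: integral_ge0 => x _; rewrite lee_fin powR_ge0.
have If : I \is a fin_num by rewrite ge0_fin_numE.
pose M := (2 `^ r * (1 + fine I + C))%R.
have M0 : (0 < M)%R.
  by rewrite mulr_gt0 ?powR_gt0// ltr_wpDl// addr_ge0// fine_ge0.
exists (M `^ r^-1)%R; first exact: powR_gt0.
move=> n alpha n0 opt; have [alpha0 _ _] := opt.
suff : (distN N 0 alpha `^ r <= M)%R.
  move=> h; rewrite -[leLHS]powRr1 ?distN_ge0// -(mulfV (_ : r != 0)%R) ?gt_eqF//.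
  by rewrite powRrM; apply: ler_powR2r h; rewrite ?invr_ge0 ?powR_ge0// ltW.
have mN := measurable_powR_fun (r + delta) (measurable_is_norm hN).
have mD := measurable_distN_powR hN r alpha0.
rewrite -lee_fin -[leLHS](probability_integral_cst P).
apply: (@le_trans _ _ (\int[P]_x ((2 `^ r)%:E *
    (1%:E + (N x `^ (r + delta))%:E + (distN N x alpha `^ r)%:E)))).
  apply: ge0_le_integral_nonmeasurable => x; rewrite ?lee_fin ?powR_ge0//.
  have N0 := is_norm_ge0 hN x.
  have D0 := distN_ge0 hN x alpha.
  apply: (@le_trans _ _ ((N x + distN N x alpha) `^ r)%R).
    apply: ler_powR2r; [exact: ltW|exact: distN_ge0|].
    by have := distN_lip hN 0 x alpha0; rewrite sub0r is_normN// addrC.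
  apply: le_trans (powRD_le (ltW hr) N0 D0) _.
  rewrite ler_wpM2l ?powR_ge0// lerD2r.
  have [x1|x1] := leP 1%R (N x).
    apply: (@le_trans _ _ (N x `^ (r + delta))%R); last by rewrite lerDr.
    by apply: ler_powR => //; rewrite lerDl ltW.
  apply: (@le_trans _ _ 1%R); last by rewrite lerDl powR_ge0.
  by apply: powR_le1; rewrite ?N0 ltW.
rewrite ge0_integralZl_EFin//; first last.
- by apply: emeasurable_funD => //; exact: emeasurable_funD.
- by move=> x _; rewrite -!EFinD lee_fin !addr_ge0// powR_ge0.
rewrite ge0_integralD//; first last.
- by move=> x _; rewrite lee_fin powR_ge0.
- exact: emeasurable_funD.
- by move=> x _; rewrite -!EFinD lee_fin !addr_ge0// powR_ge0.
rewrite ge0_integralD//; last by move=> x _; rewrite lee_fin powR_ge0.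
rewrite probability_integral_cst -/I -(fineK If) /M EFinM lee_pmul2l ?lte_fin ?powR_gt0//.
rewrite !EFinD; apply: leeD2l; apply: le_trans (distC n alpha n0 opt) _.
rewrite lee_fin ler_piMr ?(ltW C0)//.
apply: powR_le1; first exact: ltW.
by rewrite ltW ?mesh_gt0//= mesh_le1.
Qed.

End optimal.

(** * Exchanging a node of an optimal quantizer *)

Section exchange.
Context {R : realType} {d : nat} (N : 'rV[R]_d -> R) (hN : is_norm N)
  (r : R) (hr : 0 < r).

(** Only the node nearest to [x] can make a difference when it is removed, and
    then a neighbour of that node is a substitute. *)
Lemma exchange_pointwise (s G : seq 'rV[R]_d) (D b : R) (x y : 'rV[R]_d) :
  s != [::] -> uniq s -> uniq G -> 0 <= D -> 0 <= b <= 4^-1 ->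
  {subset G <= [seq a <- s | has (fun c => (c != a) && (N (a - c) <= D)) s]} ->
  \sum_(a <- G) distN N x [set` y :: rem a s] `^ r +
    (size G)%:R * (((3/4) `^ r - (1/4) `^ r) * distN N y [set` s] `^ r *
                   \1_(cballN N y (b * distN N y [set` s])) x) <=
  (size G)%:R * distN N x [set` s] `^ r + 2 `^ r * (distN N x [set` s] `^ r + D `^ r).
Proof.
move=> s0 us uG D0 /andP[b0 b4] Gs.
have [a0 a0s xa0] := distN_attained hN x s0.
set u := distN N x [set` s]; rewrite -/u in xa0.
have u0 : 0 <= u by exact: distN_ge0.
set rho := distN N y [set` s]; have rho0 : 0 <= rho by exact: distN_ge0.
pose w := Num.min u (N (x - y)).
have w0 : 0 <= w by rewrite /w le_min u0 is_norm_ge0.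
pose E := 2 `^ r * (u `^ r + D `^ r).
have E0 : 0 <= E by rewrite mulr_ge0 ?addr_ge0 ?powR_ge0.
(* Moving [a] to [y] leaves [x] at distance at most [w], unless [a] is the
   node nearest to [x]. *)
have step a : a \in G ->
    distN N x [set` y :: rem a s] `^ r <= w `^ r + (a == a0)%:R * E.
  move=> /Gs; rewrite mem_filter => /andP[/hasP[c cs /andP[ca Nac]] as_].
  have [aE|a_a0] := eqVneq a a0.
    rewrite mul1r ler_wpDl ?powR_ge0//; apply: le_trans (powRD_le (ltW hr) u0 D0).
    apply: ler_powR2r; [exact: ltW|exact: distN_ge0|].
    have cyr : [set` y :: rem a s] c by rewrite /= inE mem_rem_uniq// !inE ca cs orbT.
    apply: le_trans (distN_le hN x cyr) _.
    by have := is_norm_triangle hN a x c; rewrite aE in Nac *; lra.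
  rewrite mul0r addr0; apply: ler_powR2r; [exact: ltW|exact: distN_ge0|].
  rewrite /w le_min; apply/andP; split; last first.
    by apply: distN_le => //; rewrite /= mem_head.
  rewrite xa0; apply: distN_le => //.
  by rewrite /= inE mem_rem_uniq// !inE [a0 == a]eq_sym a_a0 a0s orbT.
have sumle : \sum_(a <- G) distN N x [set` y :: rem a s] `^ r <=
    (size G)%:R * w `^ r + E.
  apply: (@le_trans _ _ (\sum_(a <- G) (w `^ r + (a == a0)%:R * E))).
    by rewrite big_seq_cond [leRHS]big_seq_cond; apply: ler_sum => a /andP[/step].
  rewrite big_split /= big_const_seq count_predT iter_addr_0 mulr_natl lerD2l.
  rewrite -mulr_suml ler_piMl// -natr_sum.
  rewrite (eq_bigr (fun a => if a == a0 then 1 else 0)%N); last by move=> a _; case: eqP.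
  by rewrite -big_mkcond sum1_count count_uniq_mem// lern1 leq_b1.
(* Near [y], the node [y] improves on [alpha]. *)
have gain : w `^ r + ((3/4) `^ r - (1/4) `^ r) * rho `^ r * \1_(cballN N y (b * rho)) x
    <= u `^ r.
  rewrite indicE; have [|_] := boolP (x \in _); last first.
    by rewrite mulr0 addr0; apply: ler_powR2r (ltW hr) w0 _; rewrite /w ge_min lexx.
  rewrite inE /cballN /= mulr1 => xy.
  have brho : b * rho <= 1/4 * rho by rewrite ler_wpM2r//; lra.
  have ule : 3/4 * rho <= u.
    by apply: distN_ball_ge xy => //; exists a0.
  have wle : w `^ r <= (1/4 * rho) `^ r.
    apply: ler_powR2r (ltW hr) w0 _; apply: le_trans (le_trans xy brho).
    by rewrite /w ge_min is_norm_distC// lexx orbT.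
  have rho34 : 0 <= 3/4 * rho by rewrite mulr_ge0//; lra.
  have := ler_powR2r (ltW hr) rho34 ule; rewrite !powRM// in wle * => ule'.
  rewrite mulrBl; apply: le_trans (lerD wle (lexx _)) _.
  by rewrite addrC subrK.
rewrite -/E.
apply: le_trans (lerD sumle (lexx _)) _.
by rewrite addrAC -mulrDr lerD2r ler_wpM2l.
Qed.

End exchange.

Section exchange_optimal.
Local Open Scope ereal_scope.
Context {R : realType} {d : nat} (N : 'rV[R]_d -> R) (hN : is_norm N)
  (r : R) (hr : (0 < r)%R) (P : probability (borel_rV R d) R).

Lemma gain_gt0 : (0 < (3/4) `^ r - (1/4) `^ r :> R)%R.
Proof. by rewrite subr_gt0; apply: gt0_ltr_powR; rewrite ?nnegrE//; lra. Qed.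

(** For each [a] in [G], replacing [a] by [y] does not improve an optimal
    quantizer; compare the sum of these inequalities with the integral of
    [exchange_pointwise]. *)
Lemma exchange_optimal n (s G : seq 'rV[R]_d) (D b : R) (y : 'rV[R]_d) :
  optimal_quantizer N P r n [set` s] -> distortion N P r [set` s] < +oo ->
  s != [::] -> uniq s -> (size s <= n)%N -> uniq G -> (0 <= D)%R ->
  (0 <= b <= 4^-1)%R ->
  {subset G <= [seq a <- s | has (fun c => (c != a) && (N (a - c) <= D)%R) s]} ->
  ((size G)%:R * (((3/4) `^ r - (1/4) `^ r) * distN N y [set` s] `^ r))%:E *
    P (cballN N y (b * distN N y [set` s])) <=
  (2 `^ r)%:E * (distortion N P r [set` s] + (D `^ r)%:E).
Proof.
move=> opt fin s0 us sn uG D0 b04 Gs.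
set rho := distN N y [set` s]; set e := distortion N P r [set` s].
have k0 := gain_gt0; set k := ((3/4) `^ r - _)%R in k0 *.
have e0 : 0 <= e by exact: distortion_ge0.
have ef : e \is a fin_num by rewrite ge0_fin_numE.
have ne (t : seq 'rV[R]_d) : t != [::] -> [set` t] !=set0.
  by case: t => // a t _; exists a; rewrite /= mem_head.
have mD (t : seq 'rV[R]_d) : t != [::] ->
    measurable_fun [set: borel_rV R d] (fun x => (distN N x [set` t] `^ r)%:E).
  by move=> t0; apply: measurable_distN_powR => //; exact: ne.
pose f a x : \bar R := (distN N x [set` y :: rem a s] `^ r)%:E.
pose B := cballN N y (b * rho).
have mB : measurable B by exact: measurable_cballN.
have Gk0 : (0 <= (size G)%:R * (k * rho `^ r))%R.
  by rewrite !mulr_ge0// ?powR_ge0// ltW.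
have lhs : \int[P]_x (\sum_(a <- G) f a x +
      ((size G)%:R * (k * rho `^ r))%:E * (\1_B x)%:E) =
    \sum_(a <- G) distortion N P r [set` y :: rem a s] +
      ((size G)%:R * (k * rho `^ r))%:E * P B.
  have m1B : measurable_fun setT (fun x : borel_rV R d => (\1_B x : R)%:E).
    by apply/measurable_EFinP; exact: measurable_indic.
  rewrite ge0_integralD//; first last.
  - exact: measurable_funeM.
  - by move=> x _; rewrite -EFinM lee_fin mulr_ge0.
  - by apply: emeasurable_sum => a; exact: mD.
  - by move=> x _; apply: sume_ge0 => a _; rewrite lee_fin powR_ge0.
  rewrite ge0_integral_sum//; first last.
  - by move=> a x _; rewrite lee_fin powR_ge0.
  - by move=> a; exact: mD.
  congr (_ + _); rewrite ge0_integralZl_EFin//.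
  by rewrite integral_indic// setIT.
have rhs : \int[P]_x ((size G)%:R%:E * (distN N x [set` s] `^ r)%:E +
      (2 `^ r)%:E * ((distN N x [set` s] `^ r)%:E + (D `^ r)%:E)) =
    (size G)%:R%:E * e + (2 `^ r)%:E * (e + (D `^ r)%:E).
  rewrite ge0_integralD//; first last.
  - by apply: measurable_funeM; apply: emeasurable_funD => //; exact: mD.
  - by move=> x _; rewrite -EFinD -EFinM lee_fin mulr_ge0 ?addr_ge0 ?powR_ge0.
  - by apply: measurable_funeM; exact: mD.
  - by move=> x _; rewrite -EFinM lee_fin mulr_ge0 ?powR_ge0.
  rewrite ge0_integralZl_EFin//; first last.
  - exact: mD.
  - by move=> x _; rewrite lee_fin powR_ge0.
  congr (_ + _); rewrite ge0_integralZl_EFin//; first last.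
  - by apply: emeasurable_funD => //; exact: mD.
  - by move=> x _; rewrite -EFinD lee_fin addr_ge0 ?powR_ge0.
  rewrite ge0_integralD//; first last.
  - by move=> x _; rewrite lee_fin powR_ge0.
  - exact: mD.
  - by move=> x _; rewrite lee_fin powR_ge0.
  by rewrite probability_integral_cst.
have main : \sum_(a <- G) distortion N P r [set` y :: rem a s] +
    ((size G)%:R * (k * rho `^ r))%:E * P B <=
    (size G)%:R%:E * e + (2 `^ r)%:E * (e + (D `^ r)%:E).
  rewrite -lhs -rhs; apply: ge0_le_integral_nonmeasurable => x.
    apply: adde_ge0; last by rewrite -EFinM lee_fin mulr_ge0.
    by apply: sume_ge0 => a _; rewrite lee_fin powR_ge0.
  rewrite /f sumEFin -EFinD -!EFinM -!EFinD lee_fin -mulrA.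
  exact: exchange_pointwise.
have sum_ge : (size G)%:R%:E * e <=
    \sum_(a <- G) distortion N P r [set` y :: rem a s].
  have -> : (size G)%:R%:E * e = \sum_(a <- G) e.
    by rewrite -(fineK ef) sumEFin big_const_seq count_predT iter_addr_0 -EFinM mulr_natl.
  rewrite [leLHS]big_seq [leRHS]big_seq; apply: lee_sum => a /Gs.
  rewrite mem_filter => /andP[_ as_].
  apply: (@optimal_quantizer_le_seq _ _ _ _ _ n) => //.
  by rewrite /= size_rem// prednK// lt0n size_eq0.
have Gef : (size G)%:R%:E * e \is a fin_num by rewrite fin_numM.
rewrite -(leeD2lE _ _ Gef); apply: le_trans main.
exact: leeD2r.
Qed.

End exchange_optimal.

(** * The local mass inequality *)

Section local_mass.
Local Open Scope ereal_scope.
Context {R : realType} {d : nat} (hd : (0 < d)%N)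
  (N : 'rV[R]_d -> R) (hN : is_norm N)
  (r : R) (hr : (0 < r)%R) (P : probability (borel_rV R d) R)
  (Pa Ps : {measure set (borel_rV R d) -> \bar R})
  (hPas : lebesgue_decomposition (lebesgue_rV R d) P Pa Ps)
  (hPa : exists2 A, measurable A & Pa A != 0)
  (moment : exists2 delta : R, (0 < delta)%R &
    \int[P]_x (N x `^ (r + delta))%:E < +oo).

Lemma ac_part_le A : measurable A -> Pa A <= P A.
Proof. by case: hPas => PE _ _ mA; rewrite PE// leeDl. Qed.

Lemma ac_part_charges_ball : exists (K : R) (A : set (borel_rV R d)),
  [/\ (0 < K)%R, measurable A, A `<=` cballN N 0 K & 0 < Pa A].
Proof.
have [A mA PaA] := hPa.
pose F k := A `&` cballN N 0 k.+1%:R.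
have mF k : measurable (F k) by apply: measurableI => //; exact: measurable_cballN.
have [k Fk] : exists k, Pa (F k) != 0.
  apply: contrapT => /forallNP noF; move/negP: PaA; apply.
  rewrite eq_le measure_ge0 andbT.
  have AF : A `<=` \bigcup_k F k.
    move=> x Ax; exists (Num.truncn (N x)) => //; split => //.
    by rewrite /cballN /= subr0 ltW// truncnS_gt.
  apply: le_trans (measure_sigma_subadditive Pa mF mA AF) _.
  by rewrite eseries0// => k _ _; apply/eqP/negPn/negP; exact: noF.
exists k.+1%:R, (F k); split => //; last by rewrite lt0e Fk measure_ge0.
exact: subIsetr.
Qed.

(** [P^a] charges a bounded set [A], so an optimal [n]-quantizer must put a
    positive fraction of its nodes near [A]: otherwise the balls of radius
    [theta n^(-1/d)] around these nodes would miss half of the [P^a]-mass of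
    [A], and for [theta] large this contradicts Pierce's lemma. *)
Lemma optimal_quantizer_count : exists K c n0 : R,
  [/\ (0 < K)%R, (0 < c)%R & forall n (s : seq 'rV[R]_d), (0 < n)%N ->
    (n0 <= n%:R)%R -> s != [::] -> optimal_quantizer N P r n [set` s] ->
    (c * n%:R <= (size [seq a <- s | (N a <= K)%R])%:R)%R].
Proof.
have [K [A [K0 mA AK PaA0]]] := ac_part_charges_ball.
have Pafin B : measurable B -> Pa B \is a fin_num.
  move=> mB; rewrite ge0_fin_numE//; apply: le_lt_trans (ac_part_le mB) _.
  by apply: le_lt_trans (probability_le1 P mB) _; exact: ltry.
pose p := fine (Pa A); have PaAE : Pa A = p%:E by rewrite fineK// Pafin.
have p0 : (0 < p)%R by rewrite -lte_fin -PaAE.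
have [C C0 distC] := optimal_distortion_le hd hN hr moment.
have [cV cV0 volV] := lebesgue_cballN_le hN.
have [_ Pa_ac _] := hPas.
have p20 : (0 < p / 2)%R by rewrite divr_gt0.
have [|a a0 smallP] := null_dominates_eps_delta Pa_ac _ p20.
  by have := Pafin setT measurableT; rewrite ge0_fin_numE.
(* [th] is such that half of the mass of [A] at distance [th * mesh] already
   contributes more than Pierce's bound. *)
pose th : R := ((2 * (C + 1) / p) `^ r^-1)%R.
have th_base : (0 < 2 * (C + 1) / p)%R by rewrite divr_gt0// mulr_gt0// addr_gt0.
have th0 : (0 < th)%R by exact: powR_gt0.
have thr : (th `^ r = 2 * (C + 1) / p)%R.
  by rewrite -powRrM mulVf ?gt_eqF// powRr1// ltW.
pose T : R := (th `^ d%:R)%R; have T0 : (0 < T)%R by exact: powR_gt0.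
exists (K + 1)%R, (a / (cV * T))%R, T.
split; [by rewrite addr_gt0|by rewrite divr_gt0// mulr_gt0|].
move=> n s n0 Tn s0 opt; have n0' : (0 < n%:R :> R)%R by rewrite ltr0n.
have h0 := @mesh_gt0 R d n n0; set h := mesh R d n in h0.
pose t := (th * h)%R; have t0 : (0 < t)%R by rewrite mulr_gt0.
have td : (t `^ d%:R = T / n%:R)%R by rewrite powRM ?ltW// mesh_powR_dim.
have d0 : (0 < d%:R :> R)%R by rewrite ltr0n.
have t1 : (t <= 1)%R.
  rewrite leNgt; apply/negP => t1.
  have := gt0_ltr_powR d0 _ _ t1; rewrite !nnegrE ler01 (ltW t0) powR1 td.
  by move=> /(_ isT isT); rewrite ltr_pdivlMr// mul1r ltNge Tn.
rewrite leNgt; apply/negP; set s' := [seq a <- s | _] => small.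
pose B := \big[setU/set0]_(a <- s') (cballN N a t : set (borel_rV R d)).
have mball x : measurable (cballN N x t) by exact: measurable_cballN.
have mB : measurable B by apply: bigsetU_measurable.
have PaB : Pa B <= (p / 2)%:E.
  apply: smallP => //; apply: le_trans (measure_bigsetU_le _ _ mball) _.
  apply: (@le_trans _ _ (\sum_(i <- s') (cV * t `^ d%:R)%:E)).
    by apply: lee_sum => x _; apply: volV; exact: ltW.
  rewrite sumEFin big_const_seq count_predT iter_addr_0 lee_fin td.
  move: small; rewrite mulrAC ltr_pdivlMr ?mulr_gt0// => /ltW small.
  by rewrite -[(_ *+ size _)%R]mulr_natl [leLHS]mulrA [leLHS]mulrA ler_pdivrMr// -mulrA.
pose S := A `\` B; have mS : measurable S by exact: measurableD.
have PaS : (p / 2)%:E <= Pa S.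
  have : Pa A <= Pa B + Pa S.
    apply: le_trans (measureU2 _ mB mS); apply: le_measure; rewrite ?inE//.
      exact: measurableU.
    by move=> x Ax; have [Bx|nBx] := pselect (B x); [left|right].
  rewrite PaAE -(fineK (Pafin _ mB)) -(fineK (Pafin _ mS)) -EFinD !lee_fin.
  by move: PaB; rewrite -(fineK (Pafin _ mB)) lee_fin; lra.
have far x : S x -> (t <= distN N x [set` s])%R.
  move=> [Ax nBx]; have [b bs ->] := distN_attained hN x s0.
  have [bK|bK] := leP (N b) (K + 1)%R.
    rewrite leNgt; apply/negP => xbt; apply: nBx.
    rewrite /B -bigcup_seq; exists b; last by rewrite /cballN /= ltW.
    by rewrite /= mem_filter bK.
  apply: (le_trans t1); have := AK _ Ax; rewrite /cballN /= subr0 => xK.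
  have := is_normD hN (b - x)%R x; rewrite subrK (is_norm_distC hN b x); lra.
have := distortion_markov P mS (ltW hr) (ltW t0) far.
move=> /le_trans/(_ (distC n _ n0 opt)); apply/negP; rewrite -ltNge.
apply: (@lt_le_trans _ _ ((t `^ r)%:E * (p / 2)%:E)).
  rewrite -EFinM lte_fin powRM ?ltW// thr -/h.
  have -> : (2 * (C + 1) / p * h `^ r * (p / 2) = (C + 1) * h `^ r)%R.
    by field; rewrite gt_eqF.
  by rewrite ltr_pM2r ?powR_gt0// ltrDl.
apply: lee_wpmul2l; first by rewrite lee_fin powR_ge0.
exact: le_trans PaS (ac_part_le mS).
Qed.

(** The pigeonhole principle, applied to the nodes of the bounded region of
    [optimal_quantizer_count] and a grid with half as many cells. *)
Lemma optimal_quantizer_neighbors : exists c C n1 : R,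
  [/\ (0 < c)%R, (0 < C)%R & forall n (s : seq 'rV[R]_d), (0 < n)%N ->
    (n1 <= n%:R)%R -> s != [::] -> uniq s -> optimal_quantizer N P r n [set` s] ->
    exists G : seq 'rV[R]_d, [/\ uniq G, (c * n%:R <= (size G)%:R)%R &
      {subset G <= [seq a <- s |
        has (fun a' => (a' != a) && (N (a - a') <= C * mesh R d n)%R) s]}]].
Proof.
have [K [c [n0 [K0 c0 countP]]]] := optimal_quantizer_count.
have [cg cg0 neighP] := pigeonhole_neighbors hN.
have d0 : (0 < d%:R :> R)%R by rewrite ltr0n.
have c20 : (0 < c / 2)%R by rewrite divr_gt0.
pose u : R := ((c / 2) `^ d%:R^-1)%R.
have u0 : (0 < u)%R by apply: powR_gt0.
have ud : (u `^ d%:R = c / 2)%R by rewrite -powRrM mulVf ?gt_eqF// powRr1// ltW.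
exists (c / 2)%R, (3 * cg * K / u)%R, (Num.max n0 (2 `^ d%:R / (c / 2)))%R.
split => //; first by rewrite divr_gt0// !mulr_gt0.
move=> n s n_gt0; rewrite ge_max => /andP[n0n cn] s0 us opt.
have h0 := @mesh_gt0 R d n n_gt0; set h := mesh R d n in h0 *.
have n0' : (0 < n%:R :> R)%R by rewrite ltr0n.
have count := countP n s n_gt0 n0n s0 opt.
set s' := [seq a <- s | _] in count.
(* [q ^ d = c n / 2]: a grid with at most [q ^ d] cells leaves half of the nodes
   near the origin with a neighbour in their cell. *)
pose q : R := (u / h)%R.
have q_gt0 : (0 < q)%R by rewrite divr_gt0.
have qd : (q `^ d%:R = c / 2 * n%:R)%R.
  rewrite powRM ?invr_ge0 ?ltW// ud; congr (_ * _)%R.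
  rewrite -(powR_inv1 (ltW h0)) powRAC mesh_powR_dim// powR_inv1 ?invr_ge0 ?ltW//.
  by rewrite invrK.
have q2 : (2 <= q)%R.
  rewrite leNgt; apply/negP => q2.
  have := gt0_ltr_powR d0 _ _ q2; rewrite !nnegrE (ltW q_gt0) ler0n.
  move=> /(_ isT isT); apply/negP; rewrite -leNgt qd.
  by rewrite ler_pdivrMr// mulrC in cn.
have [L [L0 L1 L2]] := nat_between_third q2.
have Ld : ((L.+1 ^ d)%:R <= c / 2 * n%:R :> R)%R.
  by rewrite natrX -powR_mulrn// -qd; apply: ler_powR2r.
have L0' : (0 < L%:R :> R)%R by rewrite ltr0n.
have DC : (cg * K / L%:R <= 3 * cg * K / u * h)%R.
  rewrite ler_pdivrMr//.
  rewrite [leRHS](_ : _ = cg * K * (3 * L%:R / q))%R; last first.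
    by rewrite /q; field; rewrite !gt_eqF.
  by rewrite ler_peMr ?(ltW (mulr_gt0 cg0 K0))// ler_pdivlMr// mul1r.
have s'K a : a \in s' -> (N a <= K)%R by rewrite mem_filter => /andP[].
have sizeG := neighP K L s' K0 L0 (filter_uniq _ us) s'K.
exists [seq a <- s' | has (fun c => (c != a) && (N (a - c) <= cg * K / L%:R)%R) s'].
split; first by rewrite !filter_uniq.
  move: sizeG; rewrite -(ler_nat R) natrD => /(le_trans count)/le_trans.
  move=> /(_ _ (lerD (lexx _) Ld)); rewrite -lerBlDr -mulrBl.
  by congr (_ * _ <= _)%R; lra.
move=> a; rewrite !mem_filter => /andP[/hasP[a' a's /andP[aa' Naa']] /andP[_ ->]].
rewrite andbT; apply/hasP; exists a'; first by move: a's; rewrite mem_filter => /andP[].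
by rewrite aa' (le_trans Naa').
Qed.

(** Moving to [y] one of the nodes which have a close neighbour costs on average
    at most a multiple of [n^(-1-r/d)], so it cannot gain more than that. *)
Lemma optimal_local_mass : exists2 C : R, (0 < C)%R & forall n alpha y (b : R),
  (0 < n)%N -> optimal_quantizer N P r n alpha -> (0 <= b <= 4^-1)%R ->
  (distN N y alpha `^ r)%:E * P (cballN N y (b * distN N y alpha)) <=
  (C * (mesh R d n `^ r / n%:R))%:E.
Proof.
have [C1 C10 distC] := optimal_distortion_le hd hN hr moment.
have [c [C3 [n1 [c0 C30 neighP]]]] := optimal_quantizer_neighbors.
have k0 := gain_gt0 hr; set k := ((3/4) `^ r - _)%R in k0.
have q0 : (0 < (3/4) `^ r :> R)%R by apply: powR_gt0; lra.
set q := ((3/4) `^ r)%R in q0.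
pose Cbig : R := (2 `^ r * (C1 + C3 `^ r) / (k * c))%R.
have Cbig0 : (0 < Cbig)%R.
  rewrite divr_gt0//; last by rewrite mulr_gt0// divr_gt0.
  by rewrite mulr_gt0 ?powR_gt0// ltr_wpDr ?powR_ge0.
pose Csmall : R := (C1 * `|n1| / q)%R.
have Csmall0 : (0 <= Csmall)%R by rewrite divr_ge0 ?mulr_ge0// ltW.
exists (Cbig + Csmall)%R; first by rewrite ltr_wpDr.
move=> n alpha y b n_gt0 opt b04.
have h0 := @mesh_gt0 R d n n_gt0; set h := mesh R d n in h0 *.
have hr0 : (0 < h `^ r)%R by exact: powR_gt0.
have n0' : (0 < n%:R :> R)%R by rewrite ltr0n.
have hn0 : (0 < h `^ r / n%:R)%R by rewrite divr_gt0.
have [alpha0 cardalpha _] := opt.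
have distCn := distC n alpha n_gt0 opt; rewrite -/h in distCn.
have PBf : P (cballN N y (b * distN N y alpha)) \is a fin_num.
  by rewrite fin_num_measure//; exact: measurable_cballN.
have [b0 b4] := andP b04.
(* For the finitely many small [n] the distortion itself is a sufficient bound. *)
have [n1n|nn1] := leP n1 n%:R; last first.
  apply: (@le_trans _ _ (Csmall * (h `^ r / n%:R))%:E); last first.
    by rewrite lee_fin ler_pM2r// lerDr ltW.
  have := le_trans (local_mass_le_distortion hN P y (ltW hr) alpha0 b4) distCn.
  rewrite -/q -(fineK PBf) -!EFinM !lee_fin -mulrA -ler_pdivlMl// => /le_trans; apply.
  rewrite (_ : Csmall * _ = q^-1 * (C1 * h `^ r) * (`|n1| / n%:R))%R; last first.
    by rewrite /Csmall; field; rewrite !gt_eqF.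
  rewrite ler_peMr//; first by rewrite !mulr_ge0 ?invr_ge0 ?ltW.
  by rewrite ler_pdivlMr// mul1r (le_trans (ltW nn1))// ler_norm.
have [s [us sn alphaE]] := card_le_uniq_seq cardalpha.
have s0 : s != [::].
  by move/set0P : alpha0; apply: contraNneq => s0; rewrite alphaE s0 set_nil.
rewrite alphaE in opt distCn PBf *.
have [G [uG Gc Gs]] := neighP n s n_gt0 n1n s0 us opt.
have D0 : (0 <= C3 * h)%R by rewrite mulr_ge0// ltW.
have ef := le_lt_trans distCn (ltry _).
have := exchange_optimal hN hr y opt ef s0 us sn uG D0 b04 Gs.
move=> /le_trans/(_ (lee_wpmul2l _ (leeD2r _ distCn))).
rewrite lee_fin powR_ge0 => /(_ isT).
rewrite -(fineK PBf) -EFinD -!EFinM !lee_fin -/k => main.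
apply: (@le_trans _ _ (Cbig * (h `^ r / n%:R))%R); last first.
  by rewrite ler_pM2r// lerDl.
have cn0 : (0 < k * (c * n%:R))%R by rewrite !mulr_gt0.
rewrite (_ : Cbig * _ = (2 `^ r * (C1 * h `^ r + (C3 * h) `^ r)) / (k * (c * n%:R)))%R.
  rewrite ler_pdivlMr//; apply: le_trans main; rewrite -[leRHS]mulrA.
  rewrite [leLHS](_ : _ = c * n%:R * (k * distN N y [set` s] `^ r *
    fine (P (cballN N y (b * distN N y [set` s])))))%R; last by ring.
  by rewrite ler_wpM2r// !mulr_ge0 ?powR_ge0 ?fine_ge0// ltW.
by rewrite /Cbig powRM ?ltW//; field; rewrite !gt_eqF.
Qed.

End local_mass.

(** * Mass of the points far from the quantizer *)

Section dyadic.
Context {R : realType}.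

Lemma powR_le_dyadic_sum (s v : R) (m : nat) : 0 <= s -> 0 <= v -> v < 2 ^+ m ->
  v `^ s <= 1 + \sum_(k < m) (2 ^+ k.+1) `^ s * (2 ^+ k <= v)%R%:R.
Proof.
move=> s0 v0; elim: m => [|m ih] vm.
  by rewrite big_ord0 addr0 powR_le1// v0 ltW.
rewrite big_ord_recr /=; have [mv|{}/ih ih] := leP (2 ^+ m) v.
  rewrite mulr1 addrA ler_wpDl//.
    by rewrite addr_ge0// sumr_ge0// => k _; rewrite mulr_ge0 ?powR_ge0.
  by apply: ler_powR2r => //; exact: ltW.
by rewrite mulr0 addr0.
Qed.

Lemma geometric_sum_le (q : R) (m : nat) : 0 <= q < 1 ->
  \sum_(k < m) q ^+ k <= (1 - q)^-1.
Proof.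
move=> /andP[q0 q1]; have q1' : 0 < 1 - q by lra.
rewrite -[leRHS]mul1r ler_pdivlMr// mulrC -[1 - q]opprB mulNr -subrX1.
by have := exprn_ge0 m q0; lra.
Qed.

End dyadic.

Section bounded_part.
Local Open Scope ereal_scope.
Context {R : realType} {d : nat} (hd : (0 < d)%N)
  (N : 'rV[R]_d -> R) (hN : is_norm N)
  (r : R) (hr : (0 < r)%R) (P : probability (borel_rV R d) R).

Definition far_points (K u : R) (A : set 'rV[R]_d) : set (borel_rV R d) :=
  cballN N 0 K `&` [set x | (u <= distN N x A)%R].

Lemma measurable_far_points K u (A : set 'rV[R]_d) : A !=set0 ->
  measurable (far_points K u A).
Proof.
move=> A0; apply: measurableI; first exact: measurable_cballN.
rewrite [X in measurable X](_ : _ = (fun x : borel_rV R d => distN N x A) @^-1` `[u, +oo[).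
  by rewrite -[X in measurable X]setTI; exact: measurable_distN.
by apply/seteqP; split => x; rewrite /= in_itv /= andbT.
Qed.

(** The consequences of optimality on which the rest of the proof relies, with
    constants that do not depend on the size [n] of the quantizer. *)
Definition well_spread (M0 C1 : R) (n : nat) (alpha : set 'rV[R]_d) : Prop :=
  [/\ alpha !=set0, (distN N 0 alpha <= M0)%R &
    forall y (b : R), (0 <= b <= 4^-1)%R ->
    (distN N y alpha `^ r)%:E * P (cballN N y (b * distN N y alpha)) <=
    (C1 * (mesh R d n `^ r / n%:R))%:E].

(** A cell of diameter at most [u / 4] with a point at distance at least [u] from
    [alpha] has small mass by the local mass inequality, and [O(u^(-d))] such
    cells cover the ball of radius [K]. *)
Lemma far_points_tail (K M0 C1 : R) : (0 < K)%R -> (0 < M0)%R -> (0 < C1)%R ->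
  exists2 C : R, (0 < C)%R & forall n alpha (u : R), (0 < n)%N ->
    well_spread M0 C1 n alpha -> (0 < u)%R ->
    P (far_points K u alpha) <= (C * (mesh R d n / u) `^ (r + d%:R))%:E.
Proof.
move=> K0 M00 C10; have [cg cg0 gridP] := measure_le_grid hN.
pose E := (4 * cg * K + 2 * (M0 + K))%R.
have cgK0 : (0 < cg * K)%R by rewrite mulr_gt0.
have E0 : (0 < E)%R by rewrite /E; lra.
have d0 : (0 < d%:R :> R)%R by rewrite ltr0n.
exists (E `^ d%:R * C1)%R; first by rewrite mulr_gt0 ?powR_gt0.
move=> n alpha u n0 [alpha0 near0 mass] u0.
have h0 := @mesh_gt0 R d n n0; set h := mesh R d n in mass h0 *.
(* No point of the ball is farther than [M0 + K] from [alpha]; for the other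
   [u], the rounding in [L] is absorbed by [E / u]. *)
have [uK|uK] := ltP (M0 + K)%R u.
  rewrite (_ : far_points K u alpha = set0).
    by rewrite measure0 lee_fin mulr_ge0 ?powR_ge0// mulr_ge0 ?powR_ge0// ltW.
  apply/seteqP; split => // x [/=]; rewrite /cballN /= subr0 => xK ux.
  by have := distN_lip hN x 0 alpha0; rewrite subr0; lra.
pose L := (Num.truncn (4 * cg * K / u)).+1.
have v0 : (0 <= 4 * cg * K / u)%R.
  by rewrite divr_ge0 ?(ltW u0)// -mulrA mulr_ge0// ltW.
have /andP[L1 L2] := truncn_itv v0; rewrite -/L in L2.
have L0' : (0 < L%:R :> R)%R by rewrite ltr0n.
have uL : (cg * K / L%:R <= 4^-1 * u)%R.
  rewrite ler_pdivrMr//; move: L2; rewrite ltr_pdivrMr// => /ltW L2; lra.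
have LE : (L.+1%:R <= E / u)%R.
  have -> : (L.+1%:R = (Num.truncn (4 * cg * K / u))%:R + 2 :> R)%R.
    by rewrite /L -addn2 natrD.
  by rewrite /E [leRHS]mulrDl lerD// ler_pdivlMr// ler_pM2l.
pose p := (C1 * (h `^ r / n%:R) / u `^ r)%R.
have ur0 : (0 < u `^ r)%R by exact: powR_gt0.
have p0 : (0 <= p)%R.
  by rewrite divr_ge0 ?(ltW ur0)// mulr_ge0 ?(ltW C10)// divr_ge0 ?powR_ge0.
have mS := measurable_far_points K u alpha0.
apply: le_trans (gridP P K p L _ K0 isT p0 mS _ _) _.
- by move=> x [/=]; rewrite /cballN /= subr0.
- move=> x [_ /= ux].
  have PBf : P (cballN N x (4^-1 * distN N x alpha)) \is a fin_num.
    by rewrite fin_num_measure//; exact: measurable_cballN.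
  apply: (@le_trans _ _ (P (cballN N x (4^-1 * distN N x alpha)))).
    apply: le_measure; rewrite ?inE; try exact: measurable_cballN.
    by apply: cballN_le; apply: le_trans uL _; rewrite ler_pM2l// invr_gt0.
  have b4 : (0 <= (4^-1 : R) <= 4^-1)%R by rewrite lexx andbT invr_ge0.
  have := mass x _ b4; rewrite -(fineK PBf) -EFinM !lee_fin => massx.
  rewrite /p ler_pdivlMr// mulrC; apply: le_trans massx.
  rewrite ler_wpM2r ?fine_ge0//; apply: ler_powR2r => //; exact: ltW.
rewrite lee_fin; apply: (@le_trans _ _ ((E / u) `^ d%:R * p)%R).
  rewrite ler_wpM2r// natrX -powR_mulrn//; apply: ler_powR2r => //.
rewrite le_eqVlt; apply/orP; left; apply/eqP.
rewrite powRD; last by rewrite (gt_eqF (divr_gt0 h0 u0)) implybT.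
rewrite !(@powRM _ _ u^-1) ?invr_ge0 ?ltW// mesh_powR_dim// /p.
by rewrite !(powRV _ (ltW u0)); field; rewrite ?gt_eqF// ?powR_gt0// ltr0n.
Qed.

(** The layer-cake formula, dyadically in units of [n^(-1/d)]; the geometric
    series converges because [s < d + r]. *)
Lemma bounded_distortion_le (s K M0 C1 : R) :
  (0 <= s)%R -> (s < d%:R + r)%R -> (0 < K)%R -> (0 < M0)%R -> (0 < C1)%R ->
  exists2 C : R, (0 < C)%R & forall n alpha, (0 < n)%N ->
    well_spread M0 C1 n alpha ->
    \int[P]_x (distN N x alpha `^ s * \1_(cballN N 0 K) x)%:E <=
    (C * mesh R d n `^ s)%:E.
Proof.
move=> s0 sdr K0 M00 C10; have [C C0 tail] := far_points_tail K0 M00 C10.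
pose w := (r + d%:R)%R; pose q : R := (2 `^ s / 2 `^ w)%R.
have w2 : (0 < 2 `^ w :> R)%R by exact: powR_gt0.
have s2 : (0 < 2 `^ s :> R)%R by exact: powR_gt0.
have q01 : (0 <= q < 1)%R.
  rewrite divr_ge0 ?powR_ge0//= ltr_pdivrMr// mul1r /powR gt_eqF//.
  by rewrite ltr_expR ltr_pM2r ?ln_gt0 ?ltr1n// /w addrC.
have q1 : (0 < 1 - q)%R by rewrite subr_gt0; case/andP: q01.
exists (1 + 2 `^ s * C / (1 - q))%R.
  by rewrite ltr_wpDr// divr_ge0 ?(ltW q1)// mulr_ge0// ltW.
move=> n alpha n0 good; have [alpha0 near0 _] := good.
have h0 := @mesh_gt0 R d n n0; set h := mesh R d n in h0 *.
have hs0 : (0 < h `^ s)%R by exact: powR_gt0.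
pose S k := far_points K (2 ^+ k * h) alpha.
have mS k : measurable (S k) by exact: measurable_far_points.
have [m Mm] : exists m : nat, ((M0 + K) / h < 2 ^+ m)%R.
  exists (Num.truncn ((M0 + K) / h)).+1; apply: lt_le_trans (truncnS_gt _) _.
  by rewrite -natrX ler_nat ltnW// ltn_expl.
pose c k : R := ((2 ^+ k.+1) `^ s)%R.
have c0 k : (0 <= c k)%R by exact: powR_ge0.
apply: (@le_trans _ _ (\int[P]_x ((h `^ s)%:E *
    (1%:E + \sum_(k < m) (c k)%:E * (\1_(S k) x)%:E)))).
  apply: ge0_le_integral_nonmeasurable => x.
    by rewrite lee_fin mulr_ge0// powR_ge0.
  under eq_bigr do rewrite -EFinM.
  rewrite sumEFin -EFinD -EFinM lee_fin indicE.
  have sum0 : (0 <= \sum_(k < m) c k * \1_(S k) x)%R.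
    by apply: sumr_ge0 => k _; rewrite mulr_ge0.
  have [|_] := boolP (x \in _); last by rewrite mulr0 mulr_ge0 ?addr_ge0 ?powR_ge0.
  rewrite inE => xK; rewrite mulr1.
  have D0 := distN_ge0 hN x alpha.
  have -> : (distN N x alpha = h * (distN N x alpha / h))%R by field; rewrite gt_eqF.
  rewrite powRM ?divr_ge0 ?(ltW h0)// ler_pM2l//.
  have xm : (distN N x alpha / h < 2 ^+ m)%R.
    apply: le_lt_trans Mm; rewrite ler_pM2r ?invr_gt0//.
    have := distN_lip hN x 0 alpha0; move: xK; rewrite /cballN /= subr0; lra.
  apply: le_trans (powR_le_dyadic_sum s0 (divr_ge0 D0 (ltW h0)) xm) _.
  rewrite lerD2l; apply: ler_sum => k _; rewrite ler_wpM2l// indicE.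
  have [kx|] := boolP (2 ^+ k <= distN N x alpha / h)%R; last by [].
  rewrite (_ : x \in S k)// inE; split => //=.
  by rewrite -ler_pdivlMr.
have m1S k : measurable_fun setT (fun x : borel_rV R d => (\1_(S k) x : R)%:E).
  by apply/measurable_EFinP; exact: measurable_indic.
have mT (k : nat) :
    measurable_fun setT (fun x : borel_rV R d => (c k)%:E * (\1_(S k) x : R)%:E).
  exact: measurable_funeM.
have T0 k (x : borel_rV R d) : 0 <= (c k)%:E * (\1_(S k) x : R)%:E.
  by rewrite -EFinM lee_fin mulr_ge0.
rewrite ge0_integralZl_EFin ?powR_ge0//; first last.
- by apply: emeasurable_funD => //; exact: emeasurable_sum.
- by move=> x _; rewrite adde_ge0 ?lee_fin// sume_ge0.
rewrite ge0_integralD//; first last.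
- exact: emeasurable_sum.
- by move=> x _; rewrite sume_ge0.
rewrite probability_integral_cst ge0_integral_sum//.
rewrite [in leRHS]mulrC EFinM lee_wpmul2l ?lee_fin ?powR_ge0//.
rewrite EFinD leeD2l//.
apply: (@le_trans _ _ (\sum_(k < m) (2 `^ s * C * q ^+ k)%:E)).
  apply: lee_sum => k _; rewrite ge0_integralZl_EFin// integral_indic// setIT.
  apply: (@le_trans _ _ ((c k)%:E * (C * (h / (2 ^+ k * h)) `^ w)%:E)).
    by rewrite lee_wpmul2l ?lee_fin// tail// mulr_gt0// exprn_gt0.
  rewrite -EFinM lee_fin le_eqVlt; apply/orP; left; apply/eqP.
  have -> : (h / (2 ^+ k * h) = (2 ^+ k)^-1)%R.
    by field; rewrite !gt_eqF ?exprn_gt0.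
  rewrite powRV ?exprn_ge0// /c !powRXn// exprS /q expr_div_n.
  by rewrite !mulrA; congr (_ * _)%R; ring.
rewrite sumEFin lee_fin -mulr_sumr; apply: ler_wpM2l (geometric_sum_le _ q01).
by rewrite mulr_ge0// ltW.
Qed.

(** Here optimality and the lower bound for the volume of balls meet: at the
    radius [t = b' d(x, alpha)] the local mass inequality bounds the quotient
    in [sup_ratio] from below. *)
Lemma sup_ratio_ge (M0 C1 b : R) : (0 < M0)%R -> (0 < C1)%R -> (0 < b)%R ->
  exists2 C : R, (0 < C)%R & forall n alpha x, (0 < n)%N ->
    well_spread M0 C1 n alpha -> (M0 <= N x)%R ->
    ((distN N x alpha / mesh R d n) `^ (d%:R + r) / C)%:E <=
    sup_ratio N P (2 * b * N x) x.
Proof.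
move=> M00 C10 b0; have [cv cv0 vol] := lebesgue_cballN_ge hN.
pose b' : R := Num.min b (4^-1)%R.
have b'0 : (0 < b')%R by rewrite /b' lt_min b0 invr_gt0 ltr0n.
have b'b : (b' <= b)%R by rewrite /b' ge_min lexx.
have b'4 : (0 <= b' <= 4^-1)%R by rewrite (ltW b'0)/= /b' ge_min lexx orbT.
have b'd : (0 < b' `^ d%:R)%R by exact: powR_gt0.
exists (C1 / (cv * b' `^ d%:R))%R; first by rewrite divr_gt0// mulr_gt0.
move=> n alpha x n0 [alpha0 near0 mass] xM.
have h0 := @mesh_gt0 R d n n0.
have D0 := distN_ge0 hN x alpha; set rho := distN N x alpha in D0 *.
have rho_le : (rho <= 2 * N x)%R.
  by have := distN_lip hN x 0 alpha0; rewrite subr0 -/rho; lra.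
have Nx0 : (0 < N x)%R by exact: lt_le_trans xM.
apply: (@le_trans _ _ (lebesgue_rV R d (cballN N x (b' * rho)) /
                       P (cballN N x (b' * rho)))); last first.
  apply: ereal_sup_ubound; exists (b' * rho)%R => //.
  rewrite /= in_itv /= mulr_ge0 ?(ltW b'0)//=.
  apply: (@le_trans _ _ (b' * (2 * N x))%R); first by rewrite ler_pM2l.
  by rewrite mulrCA -mulrA ler_pM2l// ler_pM2r.
set B := cballN N x (b' * rho).
have mB : measurable B by exact: measurable_cballN.
have dr0 : (d%:R + r != 0)%R by rewrite gt_eqF// ltr_wpDl.
have [rho00|rho_neq0] := eqVneq rho 0%R.
  by rewrite rho00 mul0r powR0// mul0r mule_ge0// inve_ge0.
have rho0 : (0 < rho)%R by rewrite lt_neqAle eq_sym rho_neq0.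
have t0 : (0 < b' * rho)%R by rewrite mulr_gt0.
have volB := vol x _ (ltW t0); rewrite -/B in volB.
have cvt0 : (0 < cv * (b' * rho) `^ d%:R)%R by rewrite mulr_gt0 ?powR_gt0.
have PBf : P B \is a fin_num by rewrite fin_num_measure.
have massx := mass x b' b'4; rewrite -/rho -/B in massx.
rewrite -(fineK PBf) in massx *; set pB := fine (P B) in massx *.
have pB0 : (0 <= pB)%R by rewrite fine_ge0.
(* A ball without mass makes the quotient infinite. *)
rewrite inver; have [pB00|pB_neq0] := eqVneq pB 0%R.
  by rewrite gt0_muley ?leey//; apply: lt_le_trans volB; rewrite lte_fin.
have {}pB0 : (0 < pB)%R by rewrite lt_neqAle eq_sym pB_neq0.
apply: le_trans (lee_wpmul2r _ volB); last by rewrite lee_fin invr_ge0 ltW.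
move: massx; rewrite -!EFinM !lee_fin -(mesh_powR_dim hd).
set h := mesh R d n in h0 *; move=> massx.
have hd0 : (0 < h `^ d%:R)%R by exact: powR_gt0.
have hr0' : (0 < h `^ r)%R by exact: powR_gt0.
have hV0 : (0 <= h^-1)%R by rewrite invr_ge0 ltW.
rewrite powRD ?(negbTE dr0)// !(powRM _ (ltW rho0) hV0).
rewrite !(powRV _ (ltW h0)) (powRM _ (ltW b'0) (ltW rho0)) ler_pdivlMr//.
have -> : (rho `^ d%:R / h `^ d%:R * (rho `^ r / h `^ r) / (C1 / (cv * b' `^ d%:R)) * pB =
  (cv * (b' `^ d%:R * rho `^ d%:R)) * ((rho `^ r * pB) / (C1 * (h `^ r * h `^ d%:R))))%R.
  by field; rewrite !gt_eqF.
rewrite ler_piMr ?mulr_ge0 ?powR_ge0 ?(ltW cv0)// ler_pdivrMr ?mul1r//.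
by rewrite !mulr_gt0.
Qed.

End bounded_part.

(** * Distortion mismatch *)

Theorem corollary2 (R : realType) (d : nat) (hd : (0 < d)%N)
  (N : 'rV[R]_d -> R) (hN : is_norm N)
  (r s : R) (hr : 0 < r) (hrs : r < s) (hs : s < d%:R + r)
  (P : probability (borel_rV R d) R)
  (Pa Ps : {measure set (borel_rV R d) -> \bar R})
  (hPas : lebesgue_decomposition (lebesgue_rV R d) P Pa Ps)
  (hPa : exists2 A, measurable A & Pa A != 0%E)
  (hmoment : exists2 delta : R, 0 < delta &
    (\int[P]_x (N x `^ (r + delta))%:E < +oo)%E)
  (alpha : nat -> set 'rV[R]_d)
  (halpha : forall n, (0 < n)%N -> optimal_quantizer N P r n (alpha n))
  (hsup : exists M b : R, [/\ 0 < M, 0 < b &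
    (\int[P]_(x in ~` cballN N 0 M)
       (sup_ratio N P (2 * b * N x) x) `^ (s / (d%:R + r)) < +oo)%E]) :
  (ereal_sup [set (n%:R `^ (s / d%:R))%:E * distortion N P s (alpha n)
             | n in [set n : nat | (0 < n)%N]] < +oo)%E.
Proof.
have [M0 M00 near0] := optimal_quantizer_bounded hd hN hr hmoment.
have [C1 C10 mass] := optimal_local_mass hd hN hr hPas hPa hmoment.
have good n : (0 < n)%N -> well_spread N r P M0 C1 n (alpha n).
  move=> n0; have [alpha0 _ _] := halpha n n0.
  split=> //; first exact: near0 n0 (halpha n n0).
  by move=> y b; exact: mass n0 (halpha n n0).
have [M [b [Mgt0 b0 fin]]] := hsup.
have s0 : 0 < s by exact: lt_trans hrs.
pose K := Num.max M M0.
have K0 : 0 < K by rewrite /K lt_max Mgt0.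
have [C2 C20 bounded] := bounded_distortion_le hd hN hr P (ltW s0) hs K0 M00 C10.
have [C3 C30 tail] := sup_ratio_ge hd hN hr P M00 C10 b0.
have dr0 : 0 < d%:R + r by rewrite ltr_wpDl.
set J := (\int[P]_(x in _) _)%E in fin.
have J0 : (0 <= J)%E by apply: integral_ge0 => x _; exact: poweR_ge0.
have Jf : J \is a fin_num by rewrite ge0_fin_numE.
pose c := C3 `^ (s / (d%:R + r)); have c0 : 0 < c by exact: powR_gt0.
apply: le_lt_trans (ltry (C2 + c * fine J)).
apply: ge_ereal_sup => _ [n /= n0 <-].
have h0 := @mesh_gt0 R d n n0; set h := mesh R d n in h0.
have hs0 : 0 < h `^ s by exact: powR_gt0.
have -> : n%:R `^ (s / d%:R) = (h `^ s)^-1.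
  by rewrite /h -powRrM mulNr powRN invrK mulrC.
have [alpha0 _ _] := good n n0.
suff : (distortion N P s (alpha n) <= (h `^ s * (C2 + c * fine J))%:E)%E.
  have hV0 : (0 <= (h `^ s)^-1%:E)%E by rewrite lee_fin invr_ge0 ltW.
  move=> /(lee_wpmul2l hV0)/le_trans; apply.
  by rewrite -EFinM mulKf// gt_eqF.
set B := cballN N 0 K.
have mB : measurable B by exact: measurable_cballN.
have mD (S : set (borel_rV R d)) : measurable S ->
    measurable_fun setT (fun x : borel_rV R d => (distN N x (alpha n) `^ s * \1_S x)%:E).
  move=> mS; under eq_fun do rewrite EFinM.
  apply: emeasurable_funM; first exact: measurable_distN_powR.
  by apply/measurable_EFinP; exact: measurable_indic.
have D0 (S : set (borel_rV R d)) (x : borel_rV R d) :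
  (0 <= (distN N x (alpha n) `^ s * \1_S x)%:E)%E by rewrite lee_fin mulr_ge0 ?powR_ge0.
have -> : distortion N P s (alpha n) =
    (\int[P]_x ((distN N x (alpha n) `^ s * \1_B x)%:E +
               (distN N x (alpha n) `^ s * \1_(~` B) x)%:E))%E.
  apply: eq_integral => x _; rewrite -EFinD -mulrDr !indicE in_setC.
  by case: (x \in B); rewrite /= ?addr0 ?add0r mulr1.
rewrite ge0_integralD//; [|exact: mD|by apply: mD; exact: measurableC].
rewrite mulrDr EFinD; apply: leeD.
  by rewrite mulrC; exact: bounded (good n n0).
pose g (x : borel_rV R d) := (distN N x (alpha n) / h) `^ s / c * \1_(~` B) x.
have gE x : (distN N x (alpha n) `^ s * \1_(~` B) x)%:E = ((h `^ s * c)%:E * (g x)%:E)%E.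
  rewrite -EFinM /g powRM ?distN_ge0 ?invr_ge0 ?(ltW h0)// powRV ?(ltW h0)//.
  by congr _%:E; field; rewrite !gt_eqF.
under eq_integral do rewrite gE.
have g0 x : 0 <= g x by rewrite mulr_ge0// divr_ge0 ?powR_ge0.
have mg : measurable_fun setT (fun x => (g x)%:E).
  have -> : (fun x => (g x)%:E) = (fun x => ((h `^ s * c)^-1%:E *
      (distN N x (alpha n) `^ s * \1_(~` B) x)%:E)%E).
    apply/funext => x; rewrite gE muleA -!EFinM mulVf ?mul1r//.
    by rewrite gt_eqF// mulr_gt0.
  by apply: measurable_funeM; apply: mD; exact: measurableC.
rewrite ge0_integralZl_EFin//; first last.
- by rewrite mulr_ge0// ltW.
- by move=> x _; rewrite lee_fin.
rewrite [in leRHS]mulrA [leRHS]EFinM fineK//.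
apply: lee_wpmul2l; first by rewrite lee_fin mulr_ge0// ltW.
rewrite /J [leRHS]integral_mkcond.
apply: ge0_le_integral_nonmeasurable => x; first by rewrite lee_fin.
rewrite patchE /g indicE in_setC; have [xB|xB] := boolP (x \in B).
  by rewrite mulr0; case: ifP => // _; exact: poweR_ge0.
have xK : K < N x.
  by rewrite ltNge; apply: contra xB => xK; rewrite inE /B /cballN /= subr0.
have xM : x \in ~` cballN N 0 M.
  rewrite inE /cballN /= subr0 => xM; move: xK; rewrite ltNge.
  by rewrite (le_trans xM)// /K le_max lexx.
rewrite xM mulr1.
have NM0 : M0 <= N x by rewrite ltW// (le_lt_trans _ xK)// /K le_max lexx orbT.
have := tail n (alpha n) x n0 (good n n0) NM0.
rewrite -/h => tailx.
have v0 : 0 <= (distN N x (alpha n) / h) `^ (d%:R + r) / C3.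
  by rewrite divr_ge0 ?powR_ge0// ltW.
have -> : (distN N x (alpha n) / h) `^ s / c =
    ((distN N x (alpha n) / h) `^ (d%:R + r) / C3) `^ (s / (d%:R + r)).
  rewrite [RHS]powRM ?powR_ge0 ?invr_ge0 ?(ltW C30)// -powRrM powRV ?(ltW C30)//.
  by rewrite mulrCA mulfV ?gt_eqF// mulr1.
rewrite -poweR_EFin; apply: gt0_ler_poweR => //.
- by rewrite divr_ge0// ltW.
- by rewrite in_itv /= lee_fin v0 leey.
- by rewrite in_itv /= leey andbT (le_trans _ tailx)// lee_fin.
Qed.
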